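(* Let $\mu$ be a Borel probability measure on $[0,1)$, and let $g$ denote the Radon–Nikodym derivative, with respect to Lebesgue measure, of the absolutely continuous part of $\mu$. Then: (1) $\{e^{2\pi i nx}\}_{n\in\mathbb{Z}}\subseteq L^2(\mu)$ is a Riesz-Fischer sequence if and only if $g$ is bounded below. (2) $\{e^{2\pi i nx}\}_{n\in\mathbb{Z}}\subseteq L^2(\mu)$ is an SCO sequence if and only if $g$ is bounded above and below. (3) $\{e^{2\pi i nx}\}_{n\in\mathbb{Z}}\subseteq L^2(\mu)$ is an ICO sequence if and only if $\mu$ is absolutely continuous and $g$ is bounded below.
   Context: Absolute continuity is with respect to Lebesgue measure on $[0,1)$. ''$g$ is bounded below'' means there is $A>0$ with $g(x)\ge A$ for Lebesgue almost every $x\in[0,1)$; ''bounded above and below'' means there are $0<A\le B<\infty$ with $A\le g(x)\le B$ for Lebesgue almost every $x\in[0,1)$. A family $\{f_n\}_{n\in\mathbb{Z}}$ in a Hilbert space $\mathcal{H}$ is a Riesz-Fischer sequence if there is $c>0$ such that $c\sum_n|a_n|^2\le\left\|\sum_n a_nf_n\right\|^2$ for all finitely supported scalar families $\{a_n\}_{n\in\mathbb{Z}}$. It is an SCO (respectively ICO) sequence if there is a surjective (respectively injective) bounded linear operator $B\in B(\mathcal{H})$ such that $\{Bf_n\}_{n\in\mathbb{Z}}$ is an orthonormal basis of $\mathcal{H}$. Here $\mathcal{H}=L^2(\mu)$. *)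

(* Defs.v *)
From HB Require Import structures.
From mathcomp Require Import all_boot all_order all_algebra finmap.
From mathcomp Require Import all_classical all_reals all_analysis.
From mathcomp Require Import measurable_realfun complex ring_quotient.

Set Implicit Arguments.
Unset Strict Implicit.
Unset Printing Implicit Defensive.

Import Order.TTheory GRing.Theory Num.Theory.

Local Open Scope classical_set_scope.
Local Open Scope complex_scope.
Local Open Scope ring_scope.

Local Notation Re := complex.Re.
Local Notation Im := complex.Im.

Section square_integrable.
Context d (T : measurableType d) (R : realType).
Variable mu : {measure set T -> \bar R}.
Implicit Types f g : T -> R[i].

(* R[i] carries no sigma-algebra, so measurability is that of the real and
   imaginary parts. *)
Definition sqint : {pred T -> R[i]} := fun f =>
  `[< [/\ measurable_fun setT (fun x => Re (f x)),
          measurable_fun setT (fun x => Im (f x)) &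
          (\int[mu]_x ((Normc.normc (f x)) ^+ 2)%:E < +oo)%E] >].

Lemma normc_sqr (z : R[i]) : Normc.normc z ^+ 2 = Re z ^+ 2 + Im z ^+ 2.
Proof. by case: z => a b /=; rewrite sqr_sqrtr// addr_ge0 ?sqr_ge0. Qed.

Lemma Lfun2P (h : T -> R) : measurable_fun setT h ->
  (\int[mu]_x ((h x) ^+ 2)%:E < +oo)%E -> h \in Lfun mu 2%:E.
Proof.
move=> mh ih; rewrite inE; apply/andP; split; rewrite inE//=.
rewrite /finite_norm unlock /Lnorm poweR_lty//.
rewrite [ltLHS](_ : _ = \int[mu]_x ((h x) ^+ 2)%:E)%E//.
apply: eq_integral => x _ /=.
by rewrite -[2%R]/(2%:R) powR_mulrn// real_normK ?num_real.
Qed.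

Lemma sqintP f : f \in sqint <->
  (fun x => Re (f x)) \in Lfun mu 2%:E /\ (fun x => Im (f x)) \in Lfun mu 2%:E.
Proof.
split.
  move=> /asboolP[mre mim ifoo].
  have le2 : forall h : T -> R, measurable_fun setT h ->
      (forall x, h x ^+ 2 <= Normc.normc (f x) ^+ 2) ->
      h \in Lfun mu 2%:E.
    move=> h mh hle; apply: Lfun2P => //.
    apply: le_lt_trans ifoo; apply: ge0_le_integral => //.
    - by move=> x _; rewrite lee_fin sqr_ge0.
    - exact/measurable_EFinP/measurable_funX.
    - apply/measurable_EFinP => /=.
      have -> : (fun x => Normc.normc (f x) ^+ 2) =
          (fun x => Re (f x) ^+ 2) \+ (fun x => Im (f x) ^+ 2).
        by apply/funext => x; rewrite normc_sqr.
      by apply: measurable_funD; exact: measurable_funX.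
    - by move=> x _; rewrite lee_fin.
  by split; apply: le2 => // x; rewrite normc_sqr ?lerDl ?lerDr sqr_ge0.
move=> [fre fim]; apply/asboolP; split.
- by move: fre; rewrite inE => /andP[+ _]; rewrite inE.
- by move: fim; rewrite inE => /andP[+ _]; rewrite inE.
under eq_integral do rewrite normc_sqr EFinD.
have ire := Lfun2_integrable_sqr fre.
have iim := Lfun2_integrable_sqr fim.
rewrite integralD//.
rewrite lte_add_pinfty//; [move: ire|move: iim] => /integrableP[_];
  under eq_integral do rewrite gee0_abs ?lee_fin ?sqr_ge0//; by [].
Qed.

Lemma sqint_submod_closed : submod_closed sqint.
Proof.
have [L0 LP] := @Lfun_submod_closed _ T R mu 2%:E (lee1n 2).
split; first by apply/sqintP; split; exact: L0.
move=> a f g /sqintP[fr fi] /sqintP[gr gi].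
apply/sqintP; split.
  rewrite (_ : (fun x => _) = Re a *: (fun x => Re (f x)) +
      (- Im a *: (fun x => Im (f x)) + (fun x => Re (g x)))).
    exact/LP/LP.
  apply/funext => x /=; rewrite !fctE/=.
  case: a (f x) (g x) => ? ? [? ?] [? ?].
  by rewrite /GRing.scale/= mulNr addrA.
rewrite (_ : (fun x => _) = Re a *: (fun x => Im (f x)) +
    (Im a *: (fun x => Re (f x)) + (fun x => Im (g x)))).
  exact/LP/LP.
apply/funext => x /=; rewrite !fctE/=.
by case: a (f x) (g x) => ? ? [? ?] [? ?]; rewrite /GRing.scale/= addrA.
Qed.

HB.instance Definition _ :=
  GRing.isSubmodClosed.Build _ _ sqint sqint_submod_closed.

Record sqintType := SqInt { sqint_fun :> T -> R[i] ; _ : sqint_fun \in sqint }.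

HB.instance Definition _ := [isSub for sqint_fun].
HB.instance Definition _ := [Choice of sqintType by <:].
HB.instance Definition _ := [SubChoice_isSubLmodule of sqintType by <:].

Lemma sqint_funD (u v : sqintType) x : (u + v) x = u x + v x.
Proof. by []. Qed.

Lemma sqint_funN (u : sqintType) x : (- u) x = - u x.
Proof. by []. Qed.

Lemma sqint_funZ a (u : sqintType) x : (a *: u) x = a * u x.
Proof. by []. Qed.

Definition ae_null : {pred sqintType} := fun u =>
  `[< {ae mu, forall x, u x = 0} >].

Lemma ae_null_zmod_closed : zmod_closed ae_null.
Proof.
split; first by apply/asboolP; exact: aeW.
move=> u v /asboolP u0 /asboolP v0; apply/asboolP.
apply: filterS2 u0 v0 => x u0 v0.
by rewrite sqint_funD sqint_funN u0 v0 subr0.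
Qed.

HB.instance Definition _ :=
  GRing.isZmodClosed.Build _ ae_null ae_null_zmod_closed.

(* The quotient of the square-integrable functions by those vanishing
   mu-almost everywhere. *)
Definition L2 := Quotient.quot ae_null.
HB.instance Definition _ := GRing.Zmodule.on L2.

Definition L2class (u : sqintType) : L2 := (\pi_L2 u)%qT.

Definition L2repr (u : L2) : sqintType := repr u.

Lemma L2class_repr (u : L2) : L2class (L2repr u) = u.
Proof. exact: reprK. Qed.

Lemma L2class_eq (u v : sqintType) :
  L2class u = L2class v <-> {ae mu, forall x, u x = v x}.
Proof.
split=> [/eqP|uv].
  rewrite -Quotient.idealrBE => /asboolP; apply: filterS => x.
  by rewrite sqint_funD sqint_funN => /subr0_eq.
apply/eqP; rewrite -Quotient.idealrBE; apply/asboolP.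
by apply: filterS uv => x uv; rewrite sqint_funD sqint_funN uv subrr.
Qed.

Lemma L2repr_class (u : sqintType) :
  {ae mu, forall x, L2repr (L2class u) x = u x}.
Proof. by apply/L2class_eq; rewrite L2class_repr. Qed.

Lemma L2classD (u v : sqintType) : L2class (u + v) = L2class u + L2class v.
Proof. exact: raddfD. Qed.

Lemma L2class0 : L2class 0 = 0.
Proof. exact: raddf0. Qed.

Definition L2scale (a : R[i]) (u : L2) : L2 := L2class (a *: L2repr u).

Lemma L2scale_class a (u : sqintType) :
  L2scale a (L2class u) = L2class (a *: u).
Proof.
apply/L2class_eq; apply: filterS (L2repr_class u) => x ux.
by rewrite !sqint_funZ ux.
Qed.

Lemma L2scaleA a b (u : L2) : L2scale a (L2scale b u) = L2scale (a * b) u.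
Proof. by rewrite [L2scale b u]/L2scale L2scale_class scalerA. Qed.

Lemma L2scale1 : left_id 1 L2scale.
Proof. by move=> u; rewrite /L2scale scale1r L2class_repr. Qed.

Lemma L2scaleDr : right_distributive L2scale +%R.
Proof.
move=> a u v; rewrite {2 3}/L2scale -L2classD -scalerDr -L2scale_class.
by rewrite L2classD !L2class_repr.
Qed.

Lemma L2scaleDl (u : L2) : {morph L2scale^~ u : a b / a + b}.
Proof. by move=> a b; rewrite /L2scale scalerDl L2classD. Qed.

HB.instance Definition _ := GRing.Zmodule_isLmodule.Build R[i] L2
  L2scaleA L2scale1 L2scaleDr L2scaleDl.

Definition cintegral (f : T -> R[i]) : R[i] :=
  (\int[mu]_x Re (f x)) +i* (\int[mu]_x Im (f x)).

Definition L2dot (u v : L2) : R[i] :=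
  cintegral (fun x => L2repr u x * (L2repr v x)^*).

Definition cintegrable f := mu.-integrable setT (EFin \o (fun x => Re (f x))) /\
  mu.-integrable setT (EFin \o (fun x => Im (f x))).

Lemma cintegralP a f g : cintegrable f -> cintegrable g ->
  cintegral (fun x => a * f x + g x) = a * cintegral f + cintegral g.
Proof.
move=> [fr fi] [gr gi]; rewrite /cintegral; case: a => a b.
have iZ (c : R) (h : T -> R) : mu.-integrable setT (EFin \o h) ->
    mu.-integrable setT (EFin \o (fun x => c * h x)).
  by move=> ih; apply: (@integrableZl _ _ _ mu setT measurableT c (EFin \o h)).
have iD (h k : T -> R) : mu.-integrable setT (EFin \o h) ->
    mu.-integrable setT (EFin \o k) ->
    mu.-integrable setT (EFin \o (fun x => h x + k x)).
  by move=> ih ik; apply: (integrableD measurableT ih ik).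
have lin3 (c1 c2 : R) (h1 h2 h3 : T -> R) :
    mu.-integrable setT (EFin \o h1) -> mu.-integrable setT (EFin \o h2) ->
    mu.-integrable setT (EFin \o h3) ->
    \int[mu]_x (c1 * h1 x + (c2 * h2 x + h3 x)) =
    c1 * (\int[mu]_x h1 x) + (c2 * (\int[mu]_x h2 x) + \int[mu]_x h3 x).
  move=> i1 i2 i3.
  rewrite RintegralD//; [|exact: iZ|by apply: iD => //; exact: iZ].
  by rewrite RintegralD//; [rewrite !RintegralZl|exact: iZ].
congr (_ +i* _) => /=.
  rewrite -addrA -mulNr -lin3//; congr Rintegral; apply/funext => x.
  by case: (f x) (g x) => ? ? [? ?] /=; rewrite mulNr addrA.
rewrite -addrA -lin3//; congr Rintegral; apply/funext => x.
by case: (f x) (g x) => ? ? [? ?] /=; rewrite addrA.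
Qed.

Lemma cintegral_ae f g : {ae mu, forall x, f x = g x} ->
  cintegrable f -> cintegrable g -> cintegral f = cintegral g.
Proof.
move=> fg [fr fi] [gr gi].
congr (_ +i* _); congr fine; apply: ae_eq_integral => //.
- exact: measurable_int fr.
- exact: measurable_int gr.
- by apply: filterS fg => x /= ->.
- exact: measurable_int fi.
- exact: measurable_int gi.
- by apply: filterS fg => x /= ->.
Qed.

Lemma cintegrable_mul (u v : sqintType) : cintegrable (fun x => u x * (v x)^*).
Proof.
have /sqintP[ur ui] := valP u; have /sqintP[vr vi] := valP v.
have iM (h k : T -> R) : h \in Lfun mu 2%:E -> k \in Lfun mu 2%:E ->
    mu.-integrable setT (EFin \o (h \* k)).
  by move=> h2 k2; apply/Lfun1_integrable/Lfun2_mul_Lfun1.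
split.
  rewrite (_ : _ \o _ = EFin \o ((fun x => Re (u x)) \* (fun x => Re (v x)) \+
      (fun x => Im (u x)) \* (fun x => Im (v x)))); last first.
    apply/funext => x /=; congr EFin; case: (u x) (v x) => ? ? [? ?] /=.
    by rewrite mulrN opprK.
  exact: (integrableD measurableT (iM _ _ ur vr) (iM _ _ ui vi)).
rewrite (_ : _ \o _ = EFin \o ((fun x => Im (u x)) \* (fun x => Re (v x)) \-
    (fun x => Re (u x)) \* (fun x => Im (v x)))); last first.
  apply/funext => x /=; congr EFin; case: (u x) (v x) => ? ? [? ?] /=.
  by rewrite mulrN addrC.
exact: (integrableB measurableT (iM _ _ ui vr) (iM _ _ ur vi)).
Qed.

Lemma L2dot_linearl (v : L2) : scalar (L2dot^~ v).
Proof.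
move=> a u w; rewrite /L2dot -cintegralP; [|exact: cintegrable_mul..].
have ae_uw : {ae mu, forall x,
    L2repr (a *: u + w) x = a * L2repr u x + L2repr w x}.
  have -> : a *: u + w = L2class (a *: L2repr u + L2repr w).
    by rewrite L2classD L2class_repr.
  by apply: filterS (L2repr_class (a *: L2repr u + L2repr w)) => x ->.
apply: cintegral_ae; last 2 first.
- exact: cintegrable_mul.
- have := cintegrable_mul (a *: L2repr u + L2repr w) (L2repr v).
  congr cintegrable; apply/funext => x.
  by rewrite sqint_funD sqint_funZ mulrDl mulrA.
by apply: filterS ae_uw => x ->; rewrite mulrDl mulrA.
Qed.

Lemma L2dotC (u v : L2) : L2dot u v = (-1) ^+ false * (L2dot v u)^*.
Proof.
rewrite mul1r /L2dot /cintegral.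
have [_ ci] := cintegrable_mul (L2repr v) (L2repr u).
rewrite -[RHS]/(conjc _) /=; congr (_ +i* _).
  congr Rintegral; apply/funext => x.
  case: (L2repr u x) (L2repr v x) => ? ? [? ?] /=.
  by rewrite !mulrN !opprK mulrC [_ * _ in X in _ + X]mulrC.
rewrite -mulN1r -RintegralZl//; congr Rintegral; apply/funext => x.
case: (L2repr u x) (L2repr v x) => ? ? [? ?] /=.
by rewrite mulN1r opprD !mulrN opprK addrC mulrC [X in _ - X]mulrC.
Qed.

Lemma L2dot_linearr (u : L2) : linear_for (Num.conj \; *%R) (L2dot u).
Proof.
move=> a v w; rewrite L2dotC mul1r L2dot_linearl rmorphD rmorphM/=.
by rewrite (L2dotC u v) (L2dotC u w) !mul1r.
Qed.

Lemma L2dot_sqr (u : L2) :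
  L2dot u u = (\int[mu]_x (Normc.normc (L2repr u x) ^+ 2))%:C.
Proof.
congr (_ +i* _).
  congr Rintegral; apply/funext => x; rewrite normc_sqr.
  by case: (L2repr u x) => ? ? /=; rewrite mulrN opprK !expr2.
rewrite -[RHS](_ : \int[mu]_x 0 = 0); last by rewrite /Rintegral integral0.
congr Rintegral; apply/funext => x.
by case: (L2repr u x) => a b /=; rewrite mulrN mulrC addrC subrr.
Qed.

Lemma L2dot_gt0 (u : L2) : u != 0 -> 0 < L2dot u u.
Proof.
move=> u0; rewrite L2dot_sqr ltcR lt_neqAle; apply/andP; split; last first.
  by apply: Rintegral_ge0 => x _; exact: sqr_ge0.
apply: contra u0 => /eqP /esym int0.
have /asboolP[mr mi ifin] := valP (L2repr u).
have mn : measurable_fun setT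
    (fun x => (Normc.normc (L2repr u x) ^+ 2)%:E : \bar R).
  apply/measurable_EFinP.
  have -> : (fun x => Normc.normc (L2repr u x) ^+ 2) =
      (fun x => Re (L2repr u x) ^+ 2) \+ (fun x => Im (L2repr u x) ^+ 2).
    by apply/funext => x; rewrite normc_sqr.
  by apply: measurable_funD; exact: measurable_funX.
have eint0 : (\int[mu]_x `|(Normc.normc (L2repr u x) ^+ 2)%:E| = 0)%E.
  under eq_integral do rewrite gee0_abs ?lee_fin ?sqr_ge0//.
  rewrite -[LHS]fineK; first by congr EFin.
  rewrite ge0_fin_numE// integral_ge0// => x _.
  by rewrite lee_fin sqr_ge0.
have /(ae_eq_integral_abs mu measurableT mn) ae0 := eint0.
rewrite -[u]L2class_repr.
rewrite -L2class0.
apply/eqP/L2class_eq; apply: filterS ae0 => x /(_ I) [] /eqP.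
by rewrite expf_eq0/= => /eqP /Normc.eq0_normc.
Qed.

HB.instance Definition _ := bilinear_isBilinear.Build R[i] L2 L2 R[i]
  *%R (Num.conj \; *%R) L2dot (L2dot_linearl, L2dot_linearr).
HB.instance Definition _ :=
  isHermitianSesquilinear.Build R[i] L2 false Num.conj L2dot L2dotC.
HB.instance Definition _ := isDotProduct.Build R[i] L2 L2dot L2dot_gt0.

Definition L2form : {dot L2 for (Num.conj : R[i] -> R[i])} := L2dot.

Lemma L2dot_class (u v : sqintType) :
  L2dot (L2class u) (L2class v) = cintegral (fun x => u x * (v x)^*).
Proof.
apply: cintegral_ae; [|exact: cintegrable_mul..].
by apply: filterS2 (L2repr_class u) (L2repr_class v) => x -> ->.
Qed.

End square_integrable.
Arguments L2dot {d T R} mu u v.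
Arguments L2form {d T R} mu.

(* The inner product is linear in its first argument. Completeness of U is not
   required by the definitions below. *)
Section hilbert_families.
Variables (R : realType) (U : lmodType R[i]).
Variable dot : {dot U for (Num.conj : R[i] -> R[i])}.
Implicit Types (f e : int -> U) (B : {linear U -> U}).

Definition dot_norm (u : U) : R[i] := sqrtC (dot u u).

Definition combination f (a : {fsfun int -> R[i] with 0}) : U :=
  \sum_(n <- finsupp a) a n *: f n.

(* In R[i], 0 < c entails that c is real. *)
Definition riesz_fischer f := exists2 c : R[i], 0 < c &
  forall a : {fsfun int -> R[i] with 0},
    c * \sum_(n <- finsupp a) `|a n| ^+ 2 <= dot_norm (combination f a) ^+ 2.

Definition bounded_operator B :=
  exists M : R[i], forall u, dot_norm (B u) <= M * dot_norm u.

(* Totality is density of the linear span. *)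
Definition orthonormal_basis e :=
  (forall m n, dot (e m) (e n) = (m == n)%:R) /\
  (forall u (eps : R[i]), 0 < eps ->
    exists a, dot_norm (u - combination e a) < eps).

Definition sco_sequence f := exists B,
  [/\ bounded_operator B, (forall v, exists u, B u = v) &
      orthonormal_basis (B \o f)].

Definition ico_sequence f := exists B,
  [/\ bounded_operator B, injective B & orthonormal_basis (B \o f)].

End hilbert_families.

Section exponentials.
Variable R : realType.
Variable mu : {finite_measure set (measurableTypeR R) -> \bar R}.

Definition expi (t : R) : R[i] := cos t +i* sin t.

Definition fourier_fun (n : int) (x : measurableTypeR R) : R[i] :=
  expi (2 * pi * n%:~R * x).

Lemma fourier_fun_sqint n : fourier_fun n \in sqint mu.
Proof.
have mlin : measurable_fun setT
    (fun x : measurableTypeR R => 2 * pi * n%:~R * x).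
  exact: measurable_funM.
apply/asboolP; split.
- apply: (measurableT_comp _ mlin).
  apply: continuous_measurable_fun; exact: continuous_cos.
- apply: (measurableT_comp _ mlin).
  apply: continuous_measurable_fun; exact: continuous_sin.
under eq_integral do rewrite normc_sqr /= cos2Dsin2.
by rewrite integral_cst// mul1e -ge0_fin_numE// fin_num_measure.
Qed.

Definition fourier (n : int) : L2 mu := L2class (SqInt (fourier_fun_sqint n)).

End exponentials.

Section lebesgue_decomposition.
Context d (T : measurableType d) (R : realType).

Definition mutually_singular (m1 m2 : set T -> \bar R) :=
  exists N, [/\ measurable N, m1 (~` N) = 0%E & m2 N = 0%E].

Definition lebesgue_decomposition (mu mua mus la : set T -> \bar R) :=
  [/\ mua `<< la, mutually_singular mus la &
      forall A, measurable A -> mu A = (mua A + mus A)%E].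

Local Open Scope charge_scope.

(* g is a version of the Radon-Nikodym derivative with respect to la of the
   absolutely continuous part of mu. *)
Definition ac_density (mu : set T -> \bar R)
    (la : {sigma_finite_measure set T -> \bar R}) (g : T -> \bar R) :=
  exists mua mus : {finite_measure set T -> \bar R},
    lebesgue_decomposition mu mua mus la /\
    {ae la, forall x, g x = ('d (charge_of_finite_measure mua) '/d la) x}.

Lemma ac_density_exists (mu : {finite_measure set T -> \bar R})
    (la : {sigma_finite_measure set T -> \bar R}) :
  exists g, ac_density mu la g.
Proof.
have muoo A : measurable A -> (mu A < +oo)%E.
  by move=> mA; rewrite -ge0_fin_numE// fin_num_measure.
have muE A : measurable A -> (fine (mu A))%:E = mu A.
  by move=> mA; rewrite fineK// fin_num_measure.
pose S := [set fine (mu A) | A in [set A | measurable A /\ la A = 0%E]].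
have supS : has_sup S.
  split; first by exists (fine (mu set0)), set0.
  exists (fine (mu setT)) => _ [A [mA _] <-].
  by rewrite fine_le ?fin_num_measure// le_measure ?inE.
have /choice[F FP] : forall n : nat, exists A, [/\ measurable A, la A = 0%E &
    sup S - n.+1%:R^-1 < fine (mu A)].
  move=> n; have n0 : 0 < n.+1%:R^-1 :> R by rewrite invr_gt0.
  by have [_ [A [mA A0] <-] ltA] := sup_adherent n0 supS; exists A.
pose N := \bigcup_n F n.
have mN : measurable N by apply: bigcup_measurable => n _; have [] := FP n.
have laN : la N = 0%E.
  apply: measure_negligible => //; apply: negligible_bigcup => n.
  by have [mF F0 _] := FP n; apply/negligibleP.
have supN : sup S <= fine (mu N).
  apply/ler_addgt0Pr => e e0.
  have [n ne] : exists n : nat, n.+1%:R^-1 < e.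
    exists (Num.truncn e^-1); rewrite invf_plt ?posrE//.
    exact: truncnS_gt.
  have [mF F0 ltF] := FP n.
  have leF : fine (mu (F n)) <= fine (mu N).
    rewrite fine_le ?fin_num_measure// le_measure ?inE//.
    exact: bigcup_sup.
  rewrite -lerBlDr; apply: le_trans leF; apply/ltW/(le_lt_trans _ ltF).
  by rewrite lerD2l lerN2 ltW.
have mNC := measurableC mN.
pose mua := mfrestr mNC (muoo _ mNC); pose mus := mfrestr mN (muoo _ mN).
exists ('d (charge_of_finite_measure mua) '/d la), mua, mus.
split; last exact: aeW.
split.
- apply/null_content_dominatesP => A mA laA.
  have mAN := measurableI _ _ mA mNC.
  have laU : la (A `|` N) = 0%E.
    apply/negligibleP; first exact: measurableU.
    by apply: negligibleU; apply/negligibleP.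
  have : fine (mu (A `|` N)) <= sup S.
    apply: sup_ubound; first by case: supS.
    by exists (A `|` N) => //; split=> //; exact: measurableU.
  have -> : A `|` N = (A `&` ~` N) `|` N.
    by rewrite setUIl setUCl setIT.
  rewrite measureU//; last by rewrite -setIA setICl setI0.
  rewrite fineD ?fin_num_measure// => leS.
  change (mu (A `&` ~` N) = 0%E); rewrite -(muE _ mAN); congr EFin.
  apply/eqP; rewrite eq_le fine_ge0// andbT.
  by rewrite -(lerD2r (fine (mu N))) add0r (le_trans leS).
- exists N; split=> //.
  by change (mu (~` N `&` N) = 0%E); rewrite setICl measure0.
- move=> A mA; change (mu A = mu (A `&` ~` N) + mu (A `&` N))%E.
  by rewrite -[X in mu X = _](setIT A) -(setUCl N) setIUr measureU;
    [by []|exact: measurableI|exact: measurableI|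
     rewrite setIACA setICl setI0].
Qed.

End lebesgue_decomposition.

Section bounds.
Context d (T : measurableType d) (R : realType).
Variables (mu : {measure set T -> \bar R}) (D : set T).
Implicit Types g : T -> \bar R.

Definition ae_bounded_below g := exists2 A : R, 0 < A &
  {ae mu, forall x, D x -> (A%:E <= g x)%E}.

Definition ae_bounded_above_below g := exists A B : R, [/\ 0 < A, A <= B &
  {ae mu, forall x, D x -> (A%:E <= g x <= B%:E)%E}].

End bounds.

(* Main.v *)
Require Import Defs.
From HB Require Import structures.
From mathcomp Require Import all_boot all_order all_algebra finmap.
From mathcomp Require Import all_classical all_reals all_analysis.
From mathcomp Require Import measurable_realfun complex ring lra.

Set Implicit Arguments.
Unset Strict Implicit.
Unset Printing Implicit Defensive.

Import Order.TTheory GRing.Theory Num.Theory.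
Import numFieldNormedType.Exports.

Local Open Scope classical_set_scope.
Local Open Scope complex_scope.
Local Open Scope ring_scope.

Local Notation Re := (@complex.Re _).
Local Notation Im := (@complex.Im _).
Local Notation normc := Normc.normc.

(** Let [nu] be Lebesgue measure on [[0, 1)], and [e_n] the exponentials.
Everything is read off from how [mu] compares with [nu].

The exponentials are orthonormal in L2 of [nu], so the Riesz-Fischer inequality
says that the L2 norm of a trigonometric polynomial for [nu] is at most a
constant times its norm for [mu]. Trigonometric polynomials are dense in L2 of
[mu + nu]; hence the inequality extends to indicator functions and amounts to
[nu E <= K * mu E] for every Borel set [E] ([dominated_riesz_fischer],
[riesz_fischer_dominated]). As the singular part of [mu] lives on a Lebesgue
null set, this domination is a lower bound on the density [g].

When [nu <= K * mu], restriction is a bounded map from L2 of [mu] to L2 of [nu].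
If [B] is bounded and carries the exponentials to an orthonormal basis [b_n],
then the coefficient of [B u] along [b_n] is the n-th Fourier coefficient of the
restriction of [u], because this holds for trigonometric polynomials
([dot_operator]). Conversely this formula defines such a [B] from any
orthonormal basis of L2 of [mu], and one is obtained from the exponentials by
Gram-Schmidt ([operator_exists]). Therefore [B] is injective exactly when
restriction is, which means that Lebesgue null sets are [mu]-null; and [B] is
surjective exactly when every function in L2 of [nu] is the restriction of one
in L2 of [mu]. If [g] is bounded above such a function can be extended by [0] on
the set carrying the singular part; if [g] is unbounded, a series of indicators
of sets on which it is large gives a function that is not a restriction
([dominated_of_sqint]).

Three classical facts are established on the way. L2 spaces are complete
([L2_complete]). In a complete space orthonormal expansions converge, so that a
linearly independent family with trivial orthogonal complement is total
([total_of_ortho0]). Finally an integrable function all of whose Fourier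
coefficients with respect to a finite measure on [[0, 1)] vanish is almost
everywhere zero ([fourier_unique]); this is the density of trigonometric
polynomials, and its proof replaces approximation of continuous functions by the
algebra of multipliers, which contains the cosine and the sine and is closed
under bounded limits, hence contains the indicators of all Borel sets. *)

(** * Enumerating the integers *)

Definition int_of_nat_code (n : nat) : int :=
  if odd n then Negz n./2 else Posz n./2.

Definition nat_code_of_int (z : int) : nat :=
  match z with Posz n => n.*2 | Negz n => n.*2.+1 end.

Lemma int_of_nat_codeK : cancel int_of_nat_code nat_code_of_int.
Proof.
move=> n; rewrite /int_of_nat_code; case: ifP => on /=.
  by rewrite -[RHS]odd_double_half on.
by rewrite -[RHS]odd_double_half on.
Qed.

Lemma nat_code_of_intK : cancel nat_code_of_int int_of_nat_code.
Proof.
case=> n; rewrite /int_of_nat_code /=; first by rewrite odd_double doubleK.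
by rewrite odd_double/= uphalf_double.
Qed.

Local Notation zof := int_of_nat_code.

(** * Inner product spaces *)

Section inner_product.
Variables (R : realType) (U : lmodType R[i]).
Variable dot : {dot U for (Num.conj : R[i] -> R[i])}.
Implicit Types (u v : U) (a : R[i]).

(** The norm as a real number: [dot_norm] takes its values in [R[i]], whose order
is only partial. *)
Definition hnorm u : R := Num.sqrt (Re (dot u u)).

Lemma normr_normc (z : R[i]) : `|z| = (normc z)%:C.
Proof. by rewrite normc_def; case: z. Qed.

Lemma normc_ge0 (z : R[i]) : 0 <= normc z.
Proof. by case: z => a b; exact: sqrtr_ge0. Qed.

Lemma hnorm_ge0 u : 0 <= hnorm u.
Proof. exact: sqrtr_ge0. Qed.

Lemma dot_selfE u : dot u u = (hnorm u ^+ 2)%:C.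
Proof.
have := dnorm_ge0 dot u; rewrite lecE => /andP[/eqP I0 R0].
by rewrite sqr_sqrtr//; case: (dot u u) I0 => a b /= ->.
Qed.

Lemma dot_normE u : dot_norm dot u = (hnorm u)%:C.
Proof.
by rewrite /dot_norm dot_selfE rmorphXn/= sqrCK// ler0c hnorm_ge0.
Qed.

Lemma hnorm_eq0 u : hnorm u = 0 -> u = 0.
Proof.
move=> u0; apply/eqP; rewrite -(dnorm_eq0 dot) dot_selfE u0.
by rewrite expr0n.
Qed.

Lemma hnorm0 : hnorm 0 = 0.
Proof. by rewrite /hnorm linear0r sqrtr0. Qed.

Lemma hnormZ a u : hnorm (a *: u) = normc a * hnorm u.
Proof.
apply/eqP; rewrite -(@eqrXn2 _ 2%N) ?hnorm_ge0 ?mulr_ge0 ?normc_ge0 ?hnorm_ge0//.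
apply/eqP; apply: complexI; rewrite -dot_selfE dnormZ dot_selfE normr_normc.
by rewrite -rmorphXn -rmorphM -exprMn.
Qed.

Lemma hnorm_opp u : hnorm (- u) = hnorm u.
Proof.
by rewrite -scaleN1r hnormZ normcN Normc.normc1 mul1r.
Qed.

Lemma hnorm_distC u v : hnorm (u - v) = hnorm (v - u).
Proof. by rewrite -hnorm_opp opprB. Qed.

Lemma dotC u v : dot u v = (dot v u)^*.
Proof. by rewrite (hermC dot u v) mul1r. Qed.

Lemma pythagoras u v : dot u v = 0 ->
  hnorm (u + v) ^+ 2 = hnorm u ^+ 2 + hnorm v ^+ 2.
Proof.
by move=> uv; apply: complexI; rewrite rmorphD/= -!dot_selfE hnormDd.
Qed.

(** Subtracting from [u] its component along [v] leaves a remainder orthogonal to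
that component, which is therefore no longer than [u]. *)
Lemma cauchy_schwarz u v : normc (dot u v) <= hnorm u * hnorm v.
Proof.
have [/hnorm_eq0 ->|v0] := eqVneq (hnorm v) 0.
  by rewrite linear0r hnorm0 mulr0 Normc.normc0.
have v_gt0 : 0 < hnorm v by rewrite lt_neqAle eq_sym v0 hnorm_ge0.
pose a := dot u v / dot v v.
have orth : dot (u - a *: v) (a *: v) = 0.
  rewrite linearZr_LR/= linearBl/= linearZl_LR/= /a divfK ?subrr ?mulr0//.
  by rewrite dot_selfE eq_complex /= eqxx andbT expf_neq0.
have := pythagoras orth; rewrite subrK => pyt.
have : hnorm (a *: v) ^+ 2 <= hnorm u ^+ 2 by rewrite pyt lerDr sqr_ge0.
rewrite ler_sqr ?nnegrE ?hnorm_ge0// hnormZ /a Normc.normcM dot_selfE Normc.normcV.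
have -> : normc (hnorm v ^+ 2)%:C = hnorm v ^+ 2.
  by rewrite /= [0 ^+ 2]expr0n addr0 sqrtr_sqr ger0_norm ?sqr_ge0.
by rewrite expr2 invfM mulrA divfK// ler_pdivrMr.
Qed.

Lemma hnorm_triangle u v : hnorm (u + v) <= hnorm u + hnorm v.
Proof.
rewrite -ler_sqr ?nnegrE ?addr_ge0 ?hnorm_ge0//.
have -> : hnorm (u + v) ^+ 2 = hnorm u ^+ 2 + hnorm v ^+ 2 + 2 * Re (dot u v).
  apply: complexI; rewrite -dot_selfE dnormD !rmorphD/= !dot_selfE; congr (_ + _).
  by case: (dot u v) => a b; simpc; rewrite mulr2n mulrDl mul1r.
rewrite sqrrD [leRHS]addrAC lerD2l -[leRHS]mulr_natl ler_pM2l//.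
apply: le_trans (cauchy_schwarz u v); case: (dot u v) => a b /=.
rewrite (le_trans (ler_norm _))// -sqrtr_sqr ler_wsqrtr// lerDl sqr_ge0//.
Qed.

Lemma hnorm_dist_triangle u v w : hnorm (u - w) <= hnorm (u - v) + hnorm (v - w).
Proof. by rewrite (le_trans _ (hnorm_triangle _ _))// addrA subrK. Qed.

Definition hcauchy (u : nat -> U) := forall e : R, 0 < e ->
  exists N, forall m n, (N <= m)%N -> (N <= n)%N -> hnorm (u m - u n) < e.

Definition hcvg (u : nat -> U) v := forall e : R, 0 < e ->
  exists N, forall n, (N <= n)%N -> hnorm (u n - v) < e.

Definition hcomplete := forall u : nat -> U, hcauchy u -> exists v, hcvg u v.

Definition orthonormal_family (e : nat -> U) :=
  forall m n, dot (e m) (e n) = (m == n)%:R.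

Definition nat_comb (f : nat -> U) (c : nat -> R[i]) N : U :=
  \sum_(k < N) c k *: f k.

Lemma dot_nat_comb f c N v :
  dot (nat_comb f c N) v = \sum_(k < N) c k * dot (f k) v.
Proof.
rewrite /nat_comb linear_sumlz; apply: eq_bigr => k _.
by rewrite /= linearZl_LR.
Qed.

Lemma dot_comb_orthonormal e c N n : orthonormal_family e ->
  dot (nat_comb e c N) (e n) = if (n < N)%N then c n else 0.
Proof.
move=> eo; rewrite dot_nat_comb; case: ifPn => nN.
  rewrite (bigD1 (Ordinal nN))//= big1 ?addr0 ?eo ?eqxx ?mulr1//.
  move=> i; rewrite -val_eqE/= => /negPf ni.
  by rewrite eo ni mulr0.
rewrite big1// => i _; rewrite eo; case: eqP => [ni|]; rewrite ?mulr0//.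
by rewrite -ni ltn_ord in nN.
Qed.

Lemma hnorm_comb_orthonormal e c N : orthonormal_family e ->
  hnorm (nat_comb e c N) ^+ 2 = \sum_(k < N) normc (c k) ^+ 2.
Proof.
move=> eo; apply: complexI; rewrite -dot_selfE dot_nat_comb rmorph_sum/=.
apply: eq_bigr => k _; rewrite dotC dot_comb_orthonormal// ltn_ord.
by rewrite rmorphXn/= -normr_normc normCK.
Qed.

(** The partial expansion is the orthogonal projection of [u] on a span. *)
Lemma bessel e u N : orthonormal_family e ->
  \sum_(k < N) normc (dot u (e k)) ^+ 2 <= hnorm u ^+ 2.
Proof.
move=> eo; rewrite -(@hnorm_comb_orthonormal e (fun k => dot u (e k)))//; set s := nat_comb _ _ _.
have orth : dot (u - s) s = 0.
  rewrite dotC dot_nat_comb big1 ?rmorph0// => k _.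
  by rewrite linearBr/= (dotC (e k) u) (dotC (e k) s) dot_comb_orthonormal// ltn_ord subrr mulr0.
by have := pythagoras orth; rewrite subrK => ->; rewrite lerDr sqr_ge0.
Qed.

Lemma hcvg_dot (u : nat -> U) v w : hcvg u v -> forall e : R, 0 < e ->
  exists N, forall n, (N <= n)%N -> normc (dot (u n) w - dot v w) < e.
Proof.
move=> uv e e0; have w1 : 0 < hnorm w + 1 by rewrite ltr_wpDl ?hnorm_ge0.
have [N NP] := uv _ (divr_gt0 e0 w1); exists N => n /NP.
rewrite ltr_pdivlMr// => h; rewrite -linearBl/=.
apply: le_lt_trans (cauchy_schwarz _ _) _; apply: le_lt_trans h.
by rewrite ler_wpM2l ?hnorm_ge0// lerDl.
Qed.

(** This is the theorem of Riesz and Fischer. The partial sums form a Cauchy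
sequence because the squared distance between two of them is a difference of two
terms of a bounded nondecreasing sequence of reals. *)
Lemma orthonormal_expansion e (c : nat -> R[i]) (K : R) :
  hcomplete -> orthonormal_family e ->
  (forall N, \sum_(k < N) normc (c k) ^+ 2 <= K) ->
  exists v, [/\ forall k, dot v (e k) = c k, hnorm v ^+ 2 <= K &
                hcvg (nat_comb e c) v].
Proof.
move=> hc eo cK; pose S N : R := \sum_(k < N) normc (c k) ^+ 2.
have S_nd : {homo S : m n / (m <= n)%N >-> m <= n}.
  apply: homo_leq => [x //|? ? ? /le_trans|n]; first exact.
  by rewrite /S big_ord_recr/= lerDl sqr_ge0.
have diffE m n : (m <= n)%N ->
    hnorm (nat_comb e c n - nat_comb e c m) ^+ 2 = S n - S m.
  move=> mn; have orth : dot (nat_comb e c n - nat_comb e c m) (nat_comb e c m) = 0.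
    rewrite dotC dot_nat_comb big1 ?rmorph0// => k _.
    rewrite linearBr/= (dotC (e k) (nat_comb e c n)) (dotC (e k) (nat_comb e c m)) !dot_comb_orthonormal//.
    by rewrite ltn_ord (leq_trans _ mn)// subrr mulr0.
  by have := pythagoras orth; rewrite subrK !hnorm_comb_orthonormal// /S => ->; rewrite addrK.
have supS : has_sup (range S).
  by split; [exists (S 0%N), 0%N|exists K => _ [n _ <-]; exact: cK].
have cau : hcauchy (nat_comb e c).
  move=> eps eps0; have eps2 : 0 < eps ^+ 2 by rewrite exprn_gt0.
  have [_ [N _ <-] NP] := sup_adherent eps2 supS.
  have key m n : (N <= m)%N -> (m <= n)%N ->
      hnorm (nat_comb e c n - nat_comb e c m) < eps.
    move=> Nm mn; rewrite -ltr_sqr ?nnegrE ?hnorm_ge0 ?ltW// diffE//.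
    have Sn : S n <= sup (range S) by apply: sup_ubound; [case: supS|exists n].
    by have Sm := S_nd _ _ Nm; lra.
  exists N => m n Nm Nn; have [mn|/ltnW nm] := leqP m n.
    by rewrite hnorm_distC key.
  exact: key.
have [v cv] := hc _ cau; exists v; split=> //.
- move=> k; apply/eqP; rewrite -subr_eq0; apply/eqP/Normc.eq0_normc/eqP.
  rewrite eq_le normc_ge0 andbT; apply/ler_addgt0Pr => eps eps0; rewrite add0r.
  have [N NP] := hcvg_dot (e k) cv eps0.
  have := NP (maxn N k.+1); rewrite leq_maxl => /(_ isT).
  by rewrite dot_comb_orthonormal// leq_max ltnS leqnn orbT -normcN opprB => /ltW.
- have K0 : 0 <= K by have := cK 0%N; rewrite big_ord0.
  rewrite -(sqr_sqrtr K0) ler_sqr ?nnegrE ?hnorm_ge0 ?sqrtr_ge0//.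
  apply/ler_addgt0Pr => eps /cv[N /(_ _ (leqnn _)) NP].
  rewrite -[v in hnorm v](subrK (nat_comb e c N)).
  apply: le_trans (hnorm_triangle _ _) _.
  rewrite addrC lerD//; last by rewrite hnorm_distC ltW.
  by rewrite -ler_sqr ?nnegrE ?hnorm_ge0 ?sqrtr_ge0// (sqr_sqrtr K0) hnorm_comb_orthonormal.
Qed.

Definition in_span (f : nat -> U) N u := exists c, u = nat_comb f c N.

Lemma in_spanP f N a u v : in_span f N u -> in_span f N v ->
  in_span f N (a *: u + v).
Proof.
move=> [c ->] [d ->]; exists (fun k => a * c k + d k).
rewrite /nat_comb scaler_sumr -big_split/=; apply: eq_bigr => k _.
by rewrite scalerDl scalerA.
Qed.

Lemma in_span0 f N : in_span f N 0.
Proof. by exists (fun=> 0); rewrite /nat_comb big1// => k _; rewrite scale0r. Qed.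

Lemma in_span_gen f k N : (k < N)%N -> in_span f N (f k).
Proof.
move=> kN; exists (fun i => (i == k)%:R); rewrite /nat_comb (bigD1 (Ordinal kN))//=.
rewrite eqxx scale1r big1 ?addr0// => i; rewrite -val_eqE/= => /negPf ->.
by rewrite scale0r.
Qed.

Lemma in_spanZ f N a u : in_span f N u -> in_span f N (a *: u).
Proof. by move=> h; rewrite -[_ *: _]addr0; apply: in_spanP => //; exact: in_span0. Qed.

Lemma in_span_comb f N g c M : (forall k, (k < M)%N -> in_span f N (g k)) ->
  in_span f N (nat_comb g c M).
Proof.
elim: M => [|M IH] gf; first by rewrite /nat_comb big_ord0; exact: in_span0.
rewrite /nat_comb big_ord_recr/= addrC; apply: in_spanP; first exact: gf.
by apply: IH => k kM; apply: gf; rewrite ltnS ltnW.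
Qed.

Section gram_schmidt.
Variable f : nat -> U.

(** Each step subtracts the projections on all the vectors built before, so the
recursion returns the whole initial segment of the orthonormalised sequence. *)
Fixpoint gs_seq N : seq U :=
  if N is N'.+1 then
    let s := gs_seq N' in
    let r := f N' - \sum_(k < N') dot (f N') (nth 0 s k) *: nth 0 s k in
    rcons s ((hnorm r)^-1%:C *: r)
  else [::].

Definition gram_schmidt k := nth 0 (gs_seq k.+1) k.

Definition gs_residual N :=
  f N - nat_comb gram_schmidt (fun k => dot (f N) (gram_schmidt k)) N.

Lemma gs_size N : size (gs_seq N) = N.
Proof. by elim: N => //= N IH; rewrite size_rcons IH. Qed.

Lemma gs_nth N k : (k < N)%N -> nth 0 (gs_seq N) k = gram_schmidt k.
Proof.
elim: N => // N IH; rewrite ltnS leq_eqVlt => /predU1P[->//|kN].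
by rewrite /= nth_rcons gs_size kN IH.
Qed.

Lemma gram_schmidtE N :
  gram_schmidt N = (hnorm (gs_residual N))^-1%:C *: gs_residual N.
Proof.
rewrite {1}/gram_schmidt /= nth_rcons gs_size ltnn eqxx.
have -> // : \sum_(k < N) dot (f N) (nth 0 (gs_seq N) k) *: nth 0 (gs_seq N) k =
  nat_comb gram_schmidt (fun k => dot (f N) (gram_schmidt k)) N.
by apply: eq_bigr => k _; rewrite gs_nth.
Qed.

Hypothesis f_indep : forall N c, f N != nat_comb f c N.

Lemma gram_schmidt_span N : in_span f N.+1 (gram_schmidt N).
Proof.
elim/ltn_ind: N => N IH; rewrite gram_schmidtE; apply: in_spanZ.
rewrite /gs_residual addrC -scaleN1r; apply: in_spanP; last exact: in_span_gen.
apply: in_span_comb => k kN; have [c ->] := IH _ kN.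
by apply: in_span_comb => i ik; apply: in_span_gen; rewrite (leq_trans ik)// ltnW.
Qed.

Lemma gs_residual_gt0 N : 0 < hnorm (gs_residual N).
Proof.
rewrite lt_neqAle hnorm_ge0 andbT eq_sym; apply/negP => /eqP/hnorm_eq0/subr0_eq fN.
have [c cE] : in_span f N (f N).
  rewrite fN; apply: in_span_comb => k kN; have [c ->] := gram_schmidt_span k.
  by apply: in_span_comb => i ik; apply: in_span_gen; rewrite (leq_trans ik).
by have := f_indep N c; rewrite -cE eqxx.
Qed.

Lemma gram_schmidt_norm N : dot (gram_schmidt N) (gram_schmidt N) = 1.
Proof.
rewrite dot_selfE gram_schmidtE hnormZ.
have r0 := gs_residual_gt0 N.
have -> : normc (hnorm (gs_residual N))^-1%:C = (hnorm (gs_residual N))^-1.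
  by rewrite /= [0 ^+ 2]expr0n addr0 sqrtr_sqr ger0_norm// invr_ge0 hnorm_ge0.
by rewrite mulVf ?expr1n// gt_eqF.
Qed.

Lemma gram_schmidt_orthonormal : orthonormal_family gram_schmidt.
Proof.
suff lt m n : (m < n)%N -> dot (gram_schmidt n) (gram_schmidt m) = 0.
  move=> m n; have [mn|mn|->] := ltngtP m n.
  - by rewrite dotC lt// rmorph0.
  - by rewrite lt.
  - by rewrite gram_schmidt_norm.
elim/ltn_ind: n m => n IH m mn; rewrite gram_schmidtE linearZl_LR/=.
rewrite /gs_residual linearBl/= dot_nat_comb (bigD1 (Ordinal mn))//=.
rewrite gram_schmidt_norm mulr1 big1 ?addr0 ?subrr ?mulr0// => i.
rewrite -val_eqE/= => im; have [lim|lmi|/eqP] := ltngtP i m.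
- by rewrite (dotC (gram_schmidt i)) (IH m mn i lim) rmorph0 mulr0.
- by rewrite (IH i _ m lmi) ?mulr0.
- by rewrite (negPf im).
Qed.

Lemma span_gram_schmidt N : in_span gram_schmidt N.+1 (f N).
Proof.
have r0 := gs_residual_gt0 N.
have -> : f N = (hnorm (gs_residual N))%:C *: gram_schmidt N +
    nat_comb gram_schmidt (fun k => dot (f N) (gram_schmidt k)) N.
  rewrite gram_schmidtE scalerA -rmorphM/= divff ?gt_eqF// scale1r.
  by rewrite /gs_residual subrK.
apply: in_spanP; first exact: in_span_gen.
by apply: in_span_comb => k kN; apply: in_span_gen; exact: ltnW.
Qed.

End gram_schmidt.

(** The expansion of [u] converges to some vector, which differs from [u] by a
vector orthogonal to the whole family. *)
Lemma complete_orthonormal_total e : hcomplete -> orthonormal_family e ->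
  (forall u, (forall k, dot u (e k) = 0) -> u = 0) ->
  forall u, hcvg (nat_comb e (fun k => dot u (e k))) u.
Proof.
move=> hc eo e0 u.
have [v [vc _ cv]] := @orthonormal_expansion e (fun k => dot u (e k)) _ hc eo (fun N => bessel u N eo).
suff uv : u = v by rewrite [X in hcvg _ X]uv.
apply/eqP; rewrite -subr_eq0; apply/eqP/e0 => k.
by rewrite linearBl/= vc subrr.
Qed.

Definition total_family (f : nat -> U) := forall u (eps : R), 0 < eps ->
  exists N c, hnorm (u - nat_comb f c N) < eps.

(** A vector orthogonal to a total family is orthogonal to vectors arbitrarily
close to itself. *)
Lemma total_eq0 f u : total_family f -> (forall k, dot u (f k) = 0) -> u = 0.
Proof.
move=> tf u0; apply/hnorm_eq0/eqP; rewrite eq_le hnorm_ge0 andbT.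
apply/ler_addgt0Pr => eps /(tf u)[N [c /ltW uc]]; rewrite add0r.
have [->|un0] := eqVneq (hnorm u) 0; first exact: le_trans (hnorm_ge0 _) uc.
have u_gt0 : 0 < hnorm u by rewrite lt_neqAle eq_sym un0 hnorm_ge0.
rewrite -(ler_pM2l u_gt0); apply: le_trans (_ : hnorm u * hnorm (u - nat_comb f c N) <= _).
  have : dot u (u - nat_comb f c N) = (hnorm u ^+ 2)%:C.
    rewrite linearBr/= dot_selfE (dotC u (nat_comb _ _ _)) dot_nat_comb big1 ?rmorph0 ?subr0// => k _.
    by rewrite dotC u0 rmorph0 mulr0.
  have := cauchy_schwarz u (u - nat_comb f c N) => /[swap] ->.
  by rewrite /= [0 ^+ 2]expr0n addr0 sqrtr_sqr ger0_norm ?sqr_ge0 ?expr2.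
by rewrite ler_wpM2l ?hnorm_ge0.
Qed.

Lemma total_trans e f : (forall k, exists N, in_span f N (e k)) ->
  total_family e -> total_family f.
Proof.
move=> ef te u eps /(te u)[N [c uc]].
suff [M [d dE]] : exists M, in_span f M (nat_comb e c N) by exists M, d; rewrite -dE.
elim: N {uc} => [|N [M IH]].
  by exists 0%N; rewrite /nat_comb big_ord0; exact: in_span0.
have [L eN] := ef N; exists (maxn L M); rewrite /nat_comb big_ord_recr/= addrC.
have mono g K K' : (K <= K')%N -> in_span f K g -> in_span f K' g.
  move=> KK' [d ->]; apply: in_span_comb => k kK.
  by apply: in_span_gen; exact: leq_trans kK KK'.
by apply: in_spanP; [apply: mono eN; exact: leq_maxl|apply: mono IH; exact: leq_maxr].
Qed.

(** Gram-Schmidt preserves spans, hence orthogonal complements, and orthonormal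
families with trivial complement are total by expansion. *)
Lemma total_of_ortho0 f : hcomplete -> (forall N c, f N != nat_comb f c N) ->
  (forall u, (forall k, dot u (f k) = 0) -> u = 0) ->
  total_family f /\ exists2 e, orthonormal_family e & total_family e.
Proof.
move=> hc fi f0; have eo := gram_schmidt_orthonormal fi.
have te : total_family (gram_schmidt f).
  have e0 u : (forall k, dot u (gram_schmidt f k) = 0) -> u = 0.
    move=> ue; apply: f0 => k; have [c ->] := span_gram_schmidt fi k.
    rewrite dotC dot_nat_comb big1 ?rmorph0// => i _.
    by rewrite dotC ue rmorph0 mulr0.
  move=> u eps /(complete_orthonormal_total hc eo e0 u)[N /(_ _ (leqnn _))].
  by rewrite hnorm_distC => uN; exists N, (fun k => dot u (gram_schmidt f k)).
split; last by exists (gram_schmidt f).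
by apply: total_trans te => k; exists k.+1; exact: gram_schmidt_span.
Qed.

(** This reduces combinations indexed by the integers to partial sums of
sequences. *)
Lemma sum_finsupp_nat (V : nmodType) (G : int -> V) (s : {fset int}) N :
  (forall n, n \in s -> nat_code_of_int n < N)%N ->
  (forall n, n \notin s -> G n = 0) ->
  \sum_(n <- s) G n = \sum_(k < N) G (zof k).
Proof.
move=> sN G0; rewrite -(big_mkord xpredT (fun k => G (zof k))).
rewrite -(big_map zof xpredT G) [RHS](bigID (mem s))/= [X in _ + X]big1 ?addr0; last first.
  by move=> n /G0.
rewrite -[RHS]big_filter; apply: perm_big; apply: uniq_perm.
- exact: fset_uniq.
- by rewrite filter_uniq// map_inj_uniq ?iota_uniq//; exact: can_inj int_of_nat_codeK.
- move=> n; rewrite mem_filter; case: (boolP (n \in s)) => //= ns.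
  apply/esym/mapP; exists (nat_code_of_int n); last by rewrite nat_code_of_intK.
  by rewrite mem_index_iota/= sN.
Qed.

Lemma combination_nat (f : int -> U) (a : {fsfun int -> R[i] with 0}) :
  exists N, combination f a = nat_comb (f \o zof) (a \o zof) N /\
  \sum_(n <- finsupp a) `|a n| ^+ 2 = (\sum_(k < N) normc (a (zof k)) ^+ 2)%:C.
Proof.
exists (\max_(n <- finsupp a) nat_code_of_int n).+1.
have aN n : n \in finsupp a ->
    (nat_code_of_int n < (\max_(n <- finsupp a) nat_code_of_int n).+1)%N.
  by move=> na; rewrite ltnS (leq_bigmax_seq _ na).
split.
  rewrite /combination (sum_finsupp_nat aN)// => n /fsfun_dflt ->.
  by rewrite scale0r.
rewrite (sum_finsupp_nat aN).
  rewrite rmorph_sum; apply: eq_bigr => k _.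
  by rewrite normr_normc rmorphXn.
by move=> n /fsfun_dflt ->; rewrite normr0 expr0n.
Qed.

Lemma nat_combination (f : int -> U) (c : nat -> R[i]) N :
  exists a : {fsfun int -> R[i] with 0},
  combination f a = nat_comb (f \o zof) c N /\
  \sum_(n <- finsupp a) `|a n| ^+ 2 = (\sum_(k < N) normc (c k) ^+ 2)%:C.
Proof.
pose s := seq_fset tt (map zof (iota 0 N)).
pose a : {fsfun int -> R[i] with 0} := [fsfun n in s => c (nat_code_of_int n)].
exists a.
have sP n : (n \in s) = (nat_code_of_int n < N)%N.
  rewrite seq_fsetE; apply/mapP/idP => [[k]|nN].
    by rewrite mem_iota/= => kN ->; rewrite int_of_nat_codeK.
  by exists (nat_code_of_int n); rewrite ?mem_iota// nat_code_of_intK.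
have aN n : n \in finsupp a -> (nat_code_of_int n < N)%N.
  by rewrite mem_finsupp fsfunE sP; case: ifP => //; rewrite eqxx.
have aE (k : 'I_N) : a (zof k) = c k.
  by rewrite fsfunE sP int_of_nat_codeK ltn_ord.
split.
  rewrite /combination (sum_finsupp_nat aN); last first.
    by move=> n /fsfun_dflt ->; rewrite scale0r.
  by apply: eq_bigr => k _; rewrite aE.
rewrite (sum_finsupp_nat aN); last first.
  by move=> n /fsfun_dflt ->; rewrite normr0 expr0n.
by rewrite rmorph_sum; apply: eq_bigr => k _; rewrite aE normr_normc rmorphXn.
Qed.

Lemma riesz_fischerP (f : int -> U) : riesz_fischer dot f <->
  exists2 A : R, 0 < A & forall N (c : nat -> R[i]),
    A * \sum_(k < N) normc (c k) ^+ 2 <= hnorm (nat_comb (f \o zof) c N) ^+ 2.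
Proof.
split=> [[A A0 fA]|[A A0 fA]].
  have AE : A = (Re A)%:C.
    by apply/esym/RRe_real; rewrite realE ltW.
  rewrite AE ltcR in A0.
  exists (Re A) => // N c; have [a [fa ca]] := nat_combination f c N.
  have := fA a; rewrite fa ca dot_normE -rmorphXn [A in A * _]AE -rmorphM.
  by rewrite lecR.
exists A%:C; first by rewrite ltcR.
move=> a; have [N [-> ->]] := combination_nat f a.
by rewrite dot_normE -rmorphXn -rmorphM lecR; exact: (fA N (a \o zof)).
Qed.

(** The difference between a vector of the family and a combination of the
previous ones has a coefficient equal to [1], hence positive norm. *)
Lemma riesz_fischer_indep (f : int -> U) : riesz_fischer dot f ->
  forall N c, (f \o zof) N != nat_comb (f \o zof) c N.
Proof.
move=> /riesz_fischerP[A A0 fA] N c; apply/eqP => fN.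
have := fA N.+1 (fun k => if (k < N)%N then - c k else 1).
rewrite /nat_comb !big_ord_recr/= !ltnn scale1r.
have -> : \sum_(i < N) (if (i < N)%N then - c i else 1) *: f (zof i) =
    - nat_comb (f \o zof) c N.
  by rewrite /nat_comb -sumrN; apply: eq_bigr => i _; rewrite ltn_ord scaleNr.
rewrite -fN/= addNr hnorm0 expr0n/= leNgt pmulr_rgt0//.
rewrite addr0 expr1n sqrtr1 expr1n ltr_wpDl//.
by apply: sumr_ge0 => i _; rewrite sqr_ge0.
Qed.

Lemma orthonormal_basisP (e : int -> U) : orthonormal_basis dot e <->
  orthonormal_family (e \o zof) /\ total_family (e \o zof).
Proof.
split=> [[eo et]|[eo et]]; split.
- by move=> m n; rewrite /= eo (inj_eq (can_inj int_of_nat_codeK)).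
- move=> u eps eps0; have epsC : 0 < eps%:C by rewrite ltcR.
  have [a] := et u _ epsC; have [N [-> _]] := combination_nat e a.
  by rewrite dot_normE ltcR => h; exists N, (a \o zof).
- move=> m n; rewrite -(nat_code_of_intK m) -(nat_code_of_intK n).
  by rewrite (inj_eq (can_inj int_of_nat_codeK)) -eo.
- move=> u eps eps0.
  have epsE : eps = (Re eps)%:C by apply/esym/RRe_real; rewrite realE ltW.
  rewrite epsE ltcR in eps0 *; have [N [c h]] := et u _ eps0.
  have [a [aE _]] := nat_combination e c N.
  by exists a; rewrite aE dot_normE ltcR.
Qed.

Lemma bounded_operatorP (B : {linear U -> U}) : bounded_operator dot B <->
  exists2 M : R, 0 < M & forall u, hnorm (B u) <= M * hnorm u.
Proof.
split=> [[M BM]|[M _ BM]]; last first.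
  by exists M%:C => u; rewrite !dot_normE -rmorphM lecR.
exists (normc M + 1) => [|u]; first by rewrite ltr_wpDl ?normc_ge0.
have := BM u; rewrite !dot_normE => h.
have h0 v : `|(hnorm v)%:C| = (hnorm v)%:C :> R[i].
  by rewrite ger0_norm// ler0c hnorm_ge0.
have : `|(hnorm (B u))%:C| <= `|M * (hnorm u)%:C|.
  rewrite h0 ger0_norm//.
  by apply: le_trans h; rewrite ler0c hnorm_ge0.
rewrite normrM !h0 normr_normc -rmorphM lecR => /le_trans -> //.
by rewrite ler_wpM2r ?hnorm_ge0// lerDl.
Qed.

Lemma linear_pack (B : U -> U) : linear B ->
  exists B' : {linear U -> U}, B' =1 B.
Proof.
move=> lB; pose B' : {linear U -> U} := HB.pack B (GRing.isLinear.Build R[i] U U *:%R B lB).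
by exists B'.
Qed.

End inner_product.

(** * Completeness of square-integrable functions *)

Section L2_complete.
Context d (T : measurableType d) (R : realType).
Variable m : {measure set T -> \bar R}.

Lemma limn_einf_le (u : (\bar R)^nat) (e : \bar R) :
  (forall n, exists2 k, (n <= k)%N & (u k <= e)%E) -> (limn_einf u <= e)%E.
Proof.
move=> ue; rewrite limn_einf_lim; apply: lime_le; first exact: is_cvg_einfs.
apply: nearW => n; have [k nk uk] := ue n.
by apply: le_trans uk; apply: ereal_inf_lbound; exists k.
Qed.

Lemma cvg_of_geometric (u : R^nat) (C : R) :
  (forall k, `|u k.+1 - u k| <= C * 2^-1 ^+ k) -> cvgn u.
Proof.
move=> uC.
have cvt : cvgn (series (telescope u)).
  apply: normed_cvg; apply: (@series_le_cvg _ _ (geometric C 2^-1)).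
  - by move=> n; exact: normr_ge0.
  - by move=> n; exact: le_trans (normr_ge0 _) (uC n).
  - by move=> n; exact: uC.
  - by apply: is_cvg_geometric_series; rewrite ger0_norm// invf_lt1// ltr1n.
have -> : u = (fun n => u 0%N + series (telescope u) n).
  by apply/funext => n; rewrite -eq_sum_telescope.
by apply: is_cvgD => //; exact: is_cvg_cst.
Qed.

Lemma half_series_lty : (\sum_(0 <= k <oo) (2^-1 ^+ k : R)%:E < +oo)%E.
Proof.
have /cvg_lim : (fun k => \sum_(0 <= i < k) (2^-1 ^+ i : R)%:E)%E @ \oo -->
    (1 * (1 - 2^-1)^-1 : R)%:E.
  rewrite (_ : (fun _ => _) = EFin \o series (geometric 1 2^-1)).
    apply: cvg_EFin; first exact: nearW.
    by apply: cvg_geometric_series; rewrite ger0_norm// invf_lt1// ltr1n.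
  apply/funext => k; rewrite sumEFin /series/=; congr EFin.
  by apply: eq_bigr => i _; rewrite /geometric/= mul1r.
by move=> -> //; rewrite ltry.
Qed.

Let dist2 (f g : T -> R) : \bar R := (\int[m]_x ((f x - g x) ^+ 2)%:E)%E.

Lemma measurable_sqB (f g : T -> R) : measurable_fun setT f ->
  measurable_fun setT g -> measurable_fun setT (fun x => ((f x - g x) ^+ 2)%:E).
Proof.
move=> mf mg; apply/measurable_EFinP.
by apply: measurable_funX; exact: measurable_funB.
Qed.

(** Along a subsequence whose squared consecutive distances are at most [8 ^ - k]
the sum of [4 ^ k] times the squared increments is integrable, so that almost
everywhere the increments themselves decay geometrically. *)
Lemma real_L2_complete (h : nat -> T -> R) :
  (forall n, measurable_fun setT (h n)) ->
  (forall e : R, 0 < e -> exists N, forall i j, (N <= i)%N -> (N <= j)%N ->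
     (dist2 (h i) (h j) <= e%:E)%E) ->
  exists2 f, measurable_fun setT f &
   forall e : R, 0 < e -> exists N, forall i, (N <= i)%N ->
     (dist2 (h i) f <= e%:E)%E.
Proof.
move=> mh hC; have /choice[N NP] : forall k, exists N, forall i j,
    (N <= i)%N -> (N <= j)%N -> (dist2 (h i) (h j) <= (8^-1 ^+ k : R)%:E)%E.
  by move=> k; apply: hC; rewrite exprn_gt0// invr_gt0.
(* The sum makes the indices increase and dominate both [N k] and [k]. *)
pose n k := (\sum_(j < k.+1) (N j).+1)%N.
have nN k : (N k <= n k)%N by rewrite /n big_ord_recr/= addnS ltnW// ltnS leq_addl.
have kn k : (k <= n k)%N.
  by elim: k => // k IH; rewrite /n big_ord_recr/= addnS ltnS (leq_trans IH)// leq_addr.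
have n_nd : {homo n : i j / (i <= j)%N}.
  apply: homo_leq => [//|? ? ?|k]; first exact: leq_trans.
  by rewrite /n [leqRHS]big_ord_recr/= leq_addr.
pose q k x := (4 ^+ k * (h (n k.+1) x - h (n k) x) ^+ 2)%:E : \bar R.
have q0 k x : (0 <= q k x)%E by rewrite lee_fin mulr_ge0 ?sqr_ge0 ?exprn_ge0.
have mq k : measurable_fun setT (q k).
  apply/measurable_EFinP; apply: measurable_funM => //.
  by apply: measurable_funX; exact: measurable_funB.
pose D x := (\sum_(0 <= k <oo) q k x)%E.
have mD : measurable_fun setT D.
  by apply: ge0_emeasurable_sum => // k x _ _; exact: q0.
have intq k : (\int[m]_x q k x <= (2^-1 ^+ k : R)%:E)%E.
  rewrite /q; under eq_integral do rewrite EFinM.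
  rewrite ge0_integralZl//; last 2 first.
  - exact: measurable_sqB.
  - by move=> x _; rewrite lee_fin sqr_ge0.
  apply: (@le_trans _ _ ((4 ^+ k)%:E * (8^-1 ^+ k)%:E)%E).
    rewrite lee_pmul2l ?lte_fin ?exprn_gt0//.
    by apply: NP; [exact: leq_trans (nN k) (n_nd _ _ (leqnSn k))|exact: nN].
  rewrite -EFinM lee_fin -exprMn (_ : 4 * 8^-1 = 2^-1 :> R)//.
  by lra.
have intD : (\int[m]_x D x < +oo)%E.
  rewrite /D integral_nneseries//.
  apply: (@le_lt_trans _ _ (\sum_(0 <= k <oo) (2^-1 ^+ k : R)%:E)%E).
    by apply: lee_nneseries => // k _ _; apply: integral_ge0 => x _; exact: q0.
  exact: half_series_lty.
pose G := [set x | (D x < +oo)%E].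
have mG : measurable G.
  by rewrite -[G]setTI; exact: emeasurable_fun_infty_o.
have D0 x : (0 <= D x)%E by apply: nneseries_ge0 => k _ _; exact: q0.
have aeG : {ae m, forall x, G x}.
  have iD : m.-integrable setT D.
    apply/integrableP; split=> //.
    by under eq_integral do rewrite gee0_abs//.
  apply: filterS (integrable_ae measurableT iD) => x /(_ I).
  by rewrite ge0_fin_numE.
pose hG k x := h (n k) x * \1_G x.
have mhG k : measurable_fun setT (hG k) by apply: measurable_funM.
have hG_cvg x : cvgn (hG ^~ x).
  have [xG|xG] := pselect (G x); last first.
    rewrite (_ : hG ^~ x = cst 0); first exact: is_cvg_cst.
    by apply/funext => k; rewrite /hG indicE memNset// mulr0.
  apply: (@cvg_of_geometric _ (Num.sqrt (fine (D x)))) => k.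
  rewrite /hG indicE mem_set// !mulr1.
  have Dfin : D x \is a fin_num by rewrite ge0_fin_numE.
  have C0 : 0 <= fine (D x) by rewrite fine_ge0.
  have : (q k x <= D x)%E.
    have := @nneseries_lim_ge _ (q ^~ x) xpredT 0%N k.+1 (fun i _ _ => q0 i x).
    by apply: le_trans; rewrite big_nat_recr//= leeDr// sume_ge0.
  rewrite -[D x]fineK// lee_fin => qD.
  rewrite -(@ler_pXn2r _ 2%N)// ?nnegrE ?mulr_ge0 ?sqrtr_ge0 ?exprn_ge0 ?invr_ge0//.
  rewrite real_normK ?num_real// exprMn sqr_sqrtr//.
  rewrite exprAC -(ler_pM2l (_ : 0 < 4 ^+ k)) ?exprn_gt0//.
  apply: (le_trans qD); rewrite mulrCA -exprMn.
  by rewrite (_ : 4 * _ = 1) ?expr1n ?mulr1//; lra.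
pose f x := limn (hG ^~ x).
have mf : measurable_fun setT f.
  by apply: measurable_fun_cvg mhG _ => x _; exact: hG_cvg.
exists f => // e /hC[M MP]; exists M => i Mi.
have -> : dist2 (h i) f =
    (\int[m]_x limn_einf (fun k => ((h i x - hG k x) ^+ 2)%:E))%E.
  apply: eq_integral => x _; apply/esym/(cvg_limn_einf_sup _).1.
  apply: cvg_EFin; first exact: nearW.
  rewrite expr2; under eq_fun do rewrite expr2.
  by apply: cvgM; apply: cvgB (hG_cvg x); exact: cvg_cst.
apply: le_trans (fatou _ _ _ _) _ => //.
- by move=> k; apply: measurable_sqB.
- by move=> k x _; rewrite lee_fin sqr_ge0.
apply: limn_einf_le => k; exists (maxn k M); first exact: leq_maxl.
rewrite (_ : (\int[m]_x _)%E = dist2 (h i) (h (n (maxn k M)))).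
  apply: MP => //; exact: leq_trans (leq_maxr k M) (kn _).
apply: ge0_ae_eq_integral => //.
- exact: measurable_sqB.
- exact: measurable_sqB.
- by move=> x _; rewrite lee_fin sqr_ge0.
- by move=> x _; rewrite lee_fin sqr_ge0.
apply: filterS aeG => x Gx _ /=.
by rewrite /hG indicE mem_set// mulr1.
Qed.

Lemma measurable_normc2 (w : T -> R[i]) : measurable_fun setT (Re \o w) ->
  measurable_fun setT (Im \o w) ->
  measurable_fun setT (fun x => (normc (w x) ^+ 2)%:E).
Proof.
move=> mr mi; apply/measurable_EFinP.
rewrite (_ : (fun _ => _) =
    (fun x => Re (w x) ^+ 2) \+ (fun x => Im (w x) ^+ 2)); last first.
  by apply/funext => x /=; rewrite normc_sqr.
by apply: measurable_funD; exact: measurable_funX.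
Qed.

Lemma sqint_measurableRe (u : sqintType m) : measurable_fun setT (Re \o u).
Proof. by have /asboolP[] := valP u. Qed.

Lemma sqint_measurableIm (u : sqintType m) : measurable_fun setT (Im \o u).
Proof. by have /asboolP[] := valP u. Qed.

Lemma sqint_fin (u : sqintType m) :
  (\int[m]_x (normc (u x) ^+ 2)%:E)%E \is a fin_num.
Proof.
have /asboolP[_ _ fi] := valP u.
by rewrite ge0_fin_numE// integral_ge0// => x _; rewrite lee_fin sqr_ge0.
Qed.

Lemma hnorm_L2class (u : sqintType m) :
  ((hnorm (L2form m) (L2class u) ^+ 2)%:E = \int[m]_x (normc (u x) ^+ 2)%:E)%E.
Proof.
have := dot_selfE (L2form m) (L2class u).
rewrite [LHS]L2dot_class /cintegral => -[<- _].
rewrite -[RHS]fineK ?sqint_fin//; congr (fine _)%:E.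
apply: eq_integral => x _; rewrite normc_sqr.
by case: (u x) => a b /=; rewrite mulrN opprK !expr2.
Qed.

Lemma hnorm_L2 (u : L2 m) :
  ((hnorm (L2form m) u ^+ 2)%:E = \int[m]_x (normc (L2repr u x) ^+ 2)%:E)%E.
Proof. by rewrite -{1}(L2class_repr u) hnorm_L2class. Qed.

Lemma L2classB (u v : sqintType m) : L2class (u - v) = L2class u - L2class v.
Proof. exact: raddfB. Qed.

Lemma normc2_integralD (w : T -> R[i]) : measurable_fun setT (Re \o w) ->
  measurable_fun setT (Im \o w) ->
  (\int[m]_x (normc (w x) ^+ 2)%:E =
   \int[m]_x (Re (w x) ^+ 2)%:E + \int[m]_x (Im (w x) ^+ 2)%:E)%E.
Proof.
move=> mr mi; under eq_integral do rewrite normc_sqr EFinD.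
rewrite ge0_integralD//.
- by move=> x _; rewrite lee_fin sqr_ge0.
- by apply/measurable_EFinP; exact: measurable_funX.
- by move=> x _; rewrite lee_fin sqr_ge0.
- by apply/measurable_EFinP; exact: measurable_funX.
Qed.

(** The squared modulus is the sum of the squares of the real and imaginary
parts, to which completeness for real functions applies separately. *)
Theorem L2_complete : hcomplete (L2form m).
Proof.
move=> u uC; pose h k := L2repr (u k).
have distE i j : ((hnorm (L2form m) (u i - u j) ^+ 2)%:E =
    \int[m]_x ((Re (h i x) - Re (h j x)) ^+ 2)%:E +
    \int[m]_x ((Im (h i x) - Im (h j x)) ^+ 2)%:E)%E.
  rewrite -(L2class_repr (u i)) -(L2class_repr (u j)) -L2classB hnorm_L2class.
  rewrite normc2_integralD.
  - congr (_ + _)%E; apply: eq_integral => x _; rewrite sqint_funD sqint_funN;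
    by rewrite /h; case: (L2repr (u i) x) (L2repr (u j) x) => ? ? [? ?].
  - exact: sqint_measurableRe.
  - exact: sqint_measurableIm.
have small (e : R) : 0 < e -> exists N, forall i j, (N <= i)%N -> (N <= j)%N ->
    ((hnorm (L2form m) (u i - u j) ^+ 2)%:E <= e%:E)%E.
  move=> e0; have := uC (Num.sqrt e); rewrite sqrtr_gt0 => /(_ e0)[N NP].
  exists N => i j Ni Nj; rewrite lee_fin -(sqr_sqrtr (ltW e0)).
  by rewrite ler_sqr ?nnegrE ?hnorm_ge0 ?sqrtr_ge0// ltW// NP.
have [||fr mfr frP] := @real_L2_complete (fun k x => Re (h k x)).
- by move=> k; exact: sqint_measurableRe.
- move=> e /small[N NP]; exists N => i j Ni Nj; apply: le_trans (NP i j Ni Nj).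
  rewrite distE leeDl// integral_ge0// => x _; by rewrite lee_fin sqr_ge0.
have [||fi mfi fiP] := @real_L2_complete (fun k x => Im (h k x)).
- by move=> k; exact: sqint_measurableIm.
- move=> e /small[N NP]; exists N => i j Ni Nj; apply: le_trans (NP i j Ni Nj).
  rewrite distE leeDr// integral_ge0// => x _; by rewrite lee_fin sqr_ge0.
pose f x := fr x +i* fi x.
have close (e : R) : 0 < e -> exists N, forall i, (N <= i)%N ->
    (\int[m]_x (normc (h i x - f x) ^+ 2)%:E <= e%:E)%E.
  move=> e0; have e2 : 0 < e / 2 by rewrite divr_gt0.
  have [N NP] := frP _ e2; have [M MP] := fiP _ e2.
  exists (maxn N M) => i; rewrite geq_max => /andP[Ni Mi].
  rewrite normc2_integralD.
  - rewrite [e]splitr EFinD; apply: leeD.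
    + apply: le_trans (NP _ Ni); rewrite le_eqVlt; apply/orP; left; apply/eqP.
      by apply: eq_integral => x _ /=; case: (h i x).
    + apply: le_trans (MP _ Mi); rewrite le_eqVlt; apply/orP; left; apply/eqP.
      by apply: eq_integral => x _ /=; case: (h i x).
  - rewrite (_ : _ \o _ = (Re \o h i) \- fr); last first.
      by apply/funext => x /=; case: (h i x).
    by apply: measurable_funB => //; exact: sqint_measurableRe.
  - rewrite (_ : _ \o _ = (Im \o h i) \- fi); last first.
      by apply/funext => x /=; case: (h i x).
    by apply: measurable_funB => //; exact: sqint_measurableIm.
have fsq : f \in sqint m.
  have [N /(_ _ (leqnn _)) NP] := close 1 ltr01.
  have dsq : (fun x => h N x - f x) \in sqint m.
    apply/asboolP; split.
    + rewrite (_ : (fun _ => _) = (Re \o h N) \- fr); last first.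
        by apply/funext => x /=; case: (h N x).
      by apply: measurable_funB => //; exact: sqint_measurableRe.
    + rewrite (_ : (fun _ => _) = (Im \o h N) \- fi); last first.
        by apply/funext => x /=; case: (h N x).
      by apply: measurable_funB => //; exact: sqint_measurableIm.
    + by rewrite (le_lt_trans NP)// ltry.
  have -> : f = (h N : T -> R[i]) - (fun x => h N x - f x).
    by apply/funext => x; rewrite !fctE opprB addrCA subrr addr0.
  by rewrite rpredB//; exact: (valP (h N)).
exists (L2class (SqInt fsq)) => e e0.
have e2 : 0 < (e / 2) ^+ 2 by rewrite exprn_gt0// divr_gt0.
have [N NP] := close _ e2; exists N => n /NP Nn.
rewrite -(L2class_repr (u n)) -L2classB.
apply: (@le_lt_trans _ _ (e / 2)); last by rewrite ltr_pdivrMr// ltr_pMr// ltr1n.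
have e20 : 0 <= e / 2 by rewrite divr_ge0// ltW.
rewrite -ler_sqr ?nnegrE ?hnorm_ge0// -lee_fin hnorm_L2class.
exact: Nn.
Qed.

End L2_complete.

(** * Uniqueness of Fourier coefficients *)

Section multipliers.
Context d (T : measurableType d) (R : realType).
Variables (m : {measure set T -> \bar R}) (w : T -> R).
Hypothesis iw : m.-integrable setT (EFin \o w).
Context (I : Type) (s : I -> T -> R).
Implicit Types (f h k : T -> R).

Definition bounded_measurable f :=
  measurable_fun setT f /\ exists C, forall x, `|f x| <= C.

Lemma bounded_measurableM f h : bounded_measurable f -> bounded_measurable h ->
  bounded_measurable (fun x => f x * h x).
Proof.
move=> [mf [C fC]] [mh [K hK]]; split; first exact: measurable_funM.
by exists (C * K) => x; rewrite normrM ler_pM.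
Qed.

Lemma bounded_measurableD f h : bounded_measurable f -> bounded_measurable h ->
  bounded_measurable (fun x => f x + h x).
Proof.
move=> [mf [C fC]] [mh [K hK]]; split; first exact: measurable_funD.
by exists (C + K) => x; rewrite (le_trans (ler_normD _ _))// lerD.
Qed.

Lemma bounded_measurable_cst c : bounded_measurable (fun=> c).
Proof. by split; [exact: measurable_cst|exists `|c|]. Qed.

Lemma integrable_mul_bounded f : bounded_measurable f ->
  m.-integrable setT (EFin \o (fun x => w x * f x)).
Proof.
move=> [mf [C fC]].
have mw : measurable_fun setT w by apply/measurable_EFinP; exact: measurable_int iw.
have C0 (x : T) : 0 <= C by exact: le_trans (normr_ge0 _) (fC x).
apply: (@le_integrable _ _ _ m setT measurableT _ (fun x => (C * w x)%:E)).
- by apply/measurable_EFinP; exact: measurable_funM.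
- move=> x _ /=; rewrite lee_fin !normrM mulrC ler_wpM2r//.
  by rewrite (le_trans (fC x)) ?ler_norm.
- by apply: (@integrableZl _ _ _ m setT measurableT C (EFin \o w)).
Qed.

Definition pairing f : R := \int[m]_x (w x * f x).

Lemma pairing_linear c f h : bounded_measurable f -> bounded_measurable h ->
  pairing (fun x => c * f x + h x) = c * pairing f + pairing h.
Proof.
move=> bf bh; rewrite /pairing -RintegralZl//; last exact: integrable_mul_bounded.
rewrite -RintegralD//; last 2 first.
- have bcf : bounded_measurable (fun x => c * f x).
    by apply: bounded_measurableM => //; exact: bounded_measurable_cst.
  have := integrable_mul_bounded bcf; congr (integrable _ _ _).
  by apply/funext => x /=; rewrite mulrCA.
- exact: integrable_mul_bounded.
by congr Rintegral; apply/funext => x; rewrite mulrDr mulrCA.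
Qed.

(** Dominated convergence, with dominating function a multiple of [`|w|]. *)
Lemma pairing_cvg (f : nat -> T -> R) h C :
  (forall n, measurable_fun setT (f n)) ->
  (forall n x, `|f n x| <= C) -> (forall x, f ^~ x @ \oo --> h x) ->
  bounded_measurable h /\ pairing (f n) @[n --> \oo] --> pairing h.
Proof.
move=> mf fC fh.
have bh : bounded_measurable h.
  split; first by apply: measurable_fun_cvg mf _ => x _; exact: fh.
  exists C => x; have ch : `|f n x| @[n --> \oo] --> `|h x| by apply: cvg_norm.
  by rewrite -(cvg_lim _ ch)//; apply: limr_le; [apply/cvg_ex; exists (`|h x|)|exact: nearW].
split=> //.
have mw : measurable_fun setT w by apply/measurable_EFinP; exact: measurable_int iw.
have iCw : m.-integrable setT (fun x => (C * `|w x|)%:E).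
  apply: (@integrableZl _ _ _ m setT measurableT C (fun x => `|w x|%:E)).
  by have := integrable_abse iw.
have [] := @dominated_convergence _ _ _ m setT measurableT
  (fun n x => (w x * f n x)%:E) (fun x => (w x * h x)%:E) (fun x => (C * `|w x|)%:E).
- by move=> n; apply/measurable_EFinP; exact: measurable_funM.
- by apply/measurable_EFinP; apply: measurable_funM => //; case: bh.
- apply: aeW => x _; apply: cvg_EFin; first exact: nearW.
  by apply: cvgM; [exact: cvg_cst|exact: fh].
- exact: iCw.
- by apply: aeW => x n _; rewrite lee_fin normrM mulrC ler_wpM2r.
- move=> _ _ cv; apply: (@fine_cvg _ _ _ _ _ (pairing h)).
  rewrite /pairing /Rintegral fineK; first exact: cv.
  exact: integrable_fin_num (integrable_mul_bounded bh).
Qed.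

Definition annihilated k :=
  bounded_measurable k /\ forall i, pairing (fun x => k x * s i x) = 0.

Hypothesis bs : forall i, bounded_measurable (s i).

(** Products of annihilated functions need not be annihilated, whereas the
functions that preserve annihilation under multiplication form an algebra,
closed under bounded pointwise limits by dominated convergence. *)
Definition multiplier h :=
  bounded_measurable h /\
  forall k, annihilated k -> annihilated (fun x => h x * k x).

Lemma multiplier_cst c : multiplier (fun=> c).
Proof.
split=> [|k [bk k0]]; first exact: bounded_measurable_cst.
split=> [|i]; first by apply: bounded_measurableM => //; exact: bounded_measurable_cst.
have := @pairing_linear c _ (fun=> 0) (bounded_measurableM bk (bs i)) (bounded_measurable_cst 0).
rewrite k0 mulr0 add0r /pairing => e; transitivity (\int[m]_x (w x * 0)).
  by rewrite -e; congr Rintegral; apply/funext => x; rewrite addr0 !mulrA.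
by under eq_Rintegral do rewrite mulr0; rewrite /Rintegral integral0.
Qed.

Lemma multiplierD f h : multiplier f -> multiplier h ->
  multiplier (fun x => f x + h x).
Proof.
move=> [bf fk] [bh hk]; split=> [|k kV]; first exact: bounded_measurableD.
have [bk _] := kV; split=> [|i].
  by apply: bounded_measurableM => //; exact: bounded_measurableD.
have [bfk fk0] := fk _ kV; have [bhk hk0] := hk _ kV.
have := @pairing_linear 1 _ _ (bounded_measurableM bfk (bs i)) (bounded_measurableM bhk (bs i)).
rewrite fk0 hk0 mulr0 add0r => <-; congr Rintegral.
by apply/funext => x; rewrite mul1r -!mulrDl.
Qed.

Lemma multiplierM f h : multiplier f -> multiplier h ->
  multiplier (fun x => f x * h x).
Proof.
move=> [bf fk] [bh hk]; split=> [|k kV]; first exact: bounded_measurableM.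
have -> : (fun x => f x * h x * k x) = (fun x => f x * (h x * k x)).
  by apply/funext => x; rewrite mulrA.
exact/fk/hk.
Qed.

Lemma multiplier_cvg (f : nat -> T -> R) h C : (forall n, multiplier (f n)) ->
  (forall n x, `|f n x| <= C) -> (forall x, f ^~ x @ \oo --> h x) -> multiplier h.
Proof.
move=> fM fC fh.
have [bh _] := pairing_cvg (fun n => (fM n).1.1) fC fh.
split=> // k kV; have [bk _] := kV.
split=> [|i]; first exact: bounded_measurableM.
have [mk [K kK]] := bounded_measurableM bk (bs i).
have [|||_] := @pairing_cvg (fun n x => f n x * k x * s i x)
   (fun x => h x * k x * s i x) (C * K).
- move=> n; apply: measurable_funM; last exact: (bs i).1.
  by apply: measurable_funM; [exact: (fM n).1.1|exact: bk.1].
- by move=> n x; rewrite -mulrA normrM ler_pM.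
- by move=> x; rewrite -mulrA; under eq_fun do rewrite -mulrA; apply: cvgM => //; exact: cvg_cst.
rewrite (_ : (fun n => pairing _) = fun=> 0); last first.
  by apply/funext => n; have [_ ->] := (fM n).2 _ kV.
by move=> /cvg_lim <- //; exact: lim_cst.
Qed.

Lemma multiplierZ c f : multiplier f -> multiplier (fun x => c * f x).
Proof. by apply: multiplierM; exact: multiplier_cst. Qed.

(** The odd polynomials [y * (3 - y ^ 2) / 2], iterated, converge to the sign
function on [[-1, 1]]. *)
Definition sign_step (y : R) : R := y * (3 - y ^+ 2) / 2.

Lemma iter_sign_stepN n y : iter n sign_step (- y) = - iter n sign_step y.
Proof. by elim: n => //= n ->; rewrite /sign_step sqrrN !mulNr. Qed.

(** One has [1 - sign_step g = (1 - g) ^ 2 * (1 + g / 2)], so that a step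
multiplies the distance to [1] by at most [1 - y / 2] once [g] is above [y]. *)
Lemma iter_sign_step_bound n y : 0 < y <= 1 ->
  y <= iter n sign_step y <= 1 /\ 1 - iter n sign_step y <= (1 - y / 2) ^+ n.
Proof.
move=> /andP[y0 y1]; elim: n => [|n [/andP[IH1 IH2] IH3]] /=.
  by rewrite lexx y1 expr0; split => //; lra.
set g := iter n sign_step y in IH1 IH2 IH3 *.
have g1 : 0 <= (1 - g) ^+ 2 * (1 + g / 2) by rewrite mulr_ge0 ?sqr_ge0//; lra.
have e : 1 - sign_step g = (1 - g) ^+ 2 * (1 + g / 2).
  by rewrite /sign_step; field.
have e2 : sign_step g - g = g * (1 - g) * (1 + g) / 2 by rewrite /sign_step; field.
have g2 : 0 <= g * (1 - g) * (1 + g) / 2.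
  by rewrite divr_ge0// !mulr_ge0//; lra.
split; first by apply/andP; split; lra.
rewrite e [leRHS]exprSr; apply: (@le_trans _ _ ((1 - g) * (1 - y / 2))); last first.
  by rewrite ler_wpM2r//; lra.
rewrite expr2 -mulrA ler_wpM2l//; first by lra.
have : 0 <= g * g by rewrite mulr_ge0//; lra.
lra.
Qed.

Lemma cvg_iter_sign_step y : `|y| <= 1 -> iter n sign_step y @[n --> \oo] --> Num.sg y.
Proof.
have pos z : 0 < z <= 1 -> iter n sign_step z @[n --> \oo] --> (1 : R).
  move=> z01; have [z0 z1] := andP z01.
  apply: (@squeeze_cvgr _ _ _ _ (fun n => 1 - (1 - z / 2) ^+ n) (fun=> 1)).
  - apply: nearW => n; have [/andP[_ ->] h] := iter_sign_step_bound n z01.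
    by rewrite andbT; lra.
  - rewrite -[X in _ --> X]subr0; apply: cvgB; first exact: cvg_cst.
    by apply: cvg_expr; rewrite ger0_norm; lra.
  - exact: cvg_cst.
rewrite ler_norml => /andP[yl yu]; have [y0|y0|->] := ltgtP y 0.
- rewrite ltr0_sg// -(opprK y); under eq_fun do rewrite iter_sign_stepN.
  by apply: cvgN; apply: pos; lra.
- by rewrite gtr0_sg//; apply: pos; lra.
- rewrite sgr0 (_ : (fun n => iter n sign_step 0) = fun=> 0); first exact: cvg_cst.
  by apply/funext; elim=> //= n ->; rewrite /sign_step mul0r mul0r.
Qed.

Lemma iter_sign_step_le1 n y : `|y| <= 1 -> `|iter n sign_step y| <= 1.
Proof.
have pos z : 0 < z <= 1 -> `|iter n sign_step z| <= 1.
  move=> z01; have [/andP[h1 h2] _] := iter_sign_step_bound n z01.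
  by rewrite ger0_norm//; lra.
rewrite ler_norml => /andP[yl yu]; have [y0|y0|->] := ltgtP y 0.
- by rewrite -(opprK y) iter_sign_stepN normrN pos//; lra.
- by apply: pos; lra.
- elim: n {pos} => [|n IH]; first by rewrite normr0.
  suff -> : iter n.+1 sign_step 0 = 0 by rewrite normr0.
  by elim: n.+1 => //= k ->; rewrite /sign_step mul0r mul0r.
Qed.

Lemma multiplier_sign f : multiplier f -> (forall x, `|f x| <= 1) ->
  multiplier (fun x => Num.sg (f x)).
Proof.
move=> fM f1.
have itM n : multiplier (fun x => iter n sign_step (f x)).
  elim: n => //= n IH; rewrite /sign_step.
  have -> : (fun x => iter n sign_step (f x) * (3 - iter n sign_step (f x) ^+ 2) / 2)
    = (fun x => (3 / 2) * iter n sign_step (f x) + (- 2^-1) *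
        (iter n sign_step (f x) * (iter n sign_step (f x) * iter n sign_step (f x)))).
    by apply/funext => x; field.
  apply: multiplierD; apply: multiplierZ => //.
  by apply: multiplierM => //; exact: multiplierM.
apply: (@multiplier_cvg (fun n x => iter n sign_step (f x)) _ 1) => //.
- by move=> n x; exact: iter_sign_step_le1.
- by move=> x; exact: cvg_iter_sign_step.
Qed.

(** With [s] the sign of [f - t], the indicator of the set where [f > t] is
[(s + s ^ 2) / 2]. *)
Lemma multiplier_gt f t : multiplier f -> multiplier (\1_[set x | t < f x]).
Proof.
move=> fM; have [[_ [C fC]] _] := fM.
(* Dividing by [K] brings the values into [[-1, 1]], where the iteration
   converges. *)
pose K := `|C| + `|t| + 1.
have K0 : 0 < K by rewrite ltr_wpDl// addr_ge0.
pose y x := K^-1 * (f x + - t).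
have yM : multiplier y.
  by apply: multiplierZ; apply: multiplierD => //; exact: multiplier_cst.
have y1 x : `|y x| <= 1.
  rewrite normrM gtr0_norm ?invr_gt0// ler_pdivrMl// mulr1.
  rewrite (le_trans (ler_normB _ _))// /K -addrA lerD// ?(le_trans (fC x)) ?ler_norm//.
  by rewrite lerDl.
have sM := multiplier_sign yM y1.
have -> : \1_[set x | t < f x] =
    (fun x => 2^-1 * (Num.sg (y x) + Num.sg (y x) * Num.sg (y x))).
  apply/funext => x; rewrite indicE.
  have -> : Num.sg (y x) = Num.sg (f x - t).
    by rewrite sgrM sgrV gtr0_sg// mul1r.
  have [tf|ft] := ltP t (f x).
    by rewrite mem_set// gtr0_sg ?subr_gt0// mulr1 mulVf.
  rewrite memNset//=; last by apply/negP; rewrite -leNgt.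
  have [->|ne] := eqVneq (f x) t; first by rewrite subrr sgr0 mulr0 addr0 mulr0.
  by rewrite ltr0_sg ?subr_lt0 ?lt_neqAle ?ne// mulrNN mulr1 addNr mulr0.
by apply: multiplierZ; apply: multiplierD => //; exact: multiplierM.
Qed.

Definition multiplier_set E := multiplier (\1_E : T -> R).

Lemma multiplier_setC E : multiplier_set E -> multiplier_set (~` E).
Proof.
move=> EM; rewrite /multiplier_set.
have -> : \1_(~` E) = (fun x => 1 + (- 1) * \1_E x) :> (T -> R).
  by apply/funext => x; rewrite !indicE in_setC mulN1r;
    case: (x \in E); rewrite /= ?subrr ?subr0.
by apply: multiplierD; [exact: multiplier_cst|exact: multiplierZ].
Qed.

Lemma multiplier_setI E F : multiplier_set E -> multiplier_set F ->
  multiplier_set (E `&` F).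
Proof.
move=> EM FM; rewrite /multiplier_set.
have -> : \1_(E `&` F) = (fun x => \1_E x * \1_F x) :> (T -> R).
  by apply/funext => x; rewrite !indicE in_setI; case: (x \in E);
    rewrite /= ?mul1r ?mul0r.
exact: multiplierM.
Qed.

Lemma multiplier_setU E F : multiplier_set E -> multiplier_set F ->
  multiplier_set (E `|` F).
Proof.
move=> EM FM; rewrite -[_ `|` _]setCK setCU.
by apply/multiplier_setC/multiplier_setI; exact: multiplier_setC.
Qed.

Lemma multiplier_set0 : multiplier_set set0.
Proof.
by rewrite /multiplier_set indic0; exact: multiplier_cst.
Qed.

Lemma multiplier_bigcup (F : nat -> set T) :
  (forall n, multiplier_set (F n)) -> multiplier_set (\bigcup_n F n).
Proof.
move=> FM; pose G n := \big[setU/set0]_(i < n) F i.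
have GM n : multiplier_set (G n).
  by apply: big_ind => //; [exact: multiplier_set0|exact: multiplier_setU].
apply: (@multiplier_cvg (fun n => \1_(G n)) _ 1) => //.
  by move=> n x; rewrite indicE; case: (_ \in _); rewrite ?normr1 ?normr0.
move=> x; have [Fx|Fx] := pselect ((\bigcup_n F n) x).
  rewrite indicE mem_set//; have [i _ Fix] := Fx.
  apply: cvg_near_cst; near=> n; rewrite indicE mem_set//.
  rewrite /G -bigcup_mkord; exists i => //=.
  by near: n; exact: nbhs_infty_gt.
rewrite indicE memNset//; apply: cvg_near_cst; apply: nearW => n.
rewrite indicE memNset// /G -bigcup_mkord => -[i _ Fix].
by apply: Fx; exists i.
Unshelve. all: by end_near. Qed.

End multipliers.

Section fourier_uniqueness.
Context (R : realType).
Local Notation T := (measurableTypeR R).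
Variable mu : {finite_measure set T -> \bar R}.
Hypothesis mu01 : mu (~` `[0%R, 1%R[%classic) = 0%E.
Local Notation D := (`[0%R, 1%R[%classic : set T).

(** The real and imaginary parts of the exponentials. *)
Definition trig (i : bool * int) (x : T) : R :=
  let t := 2 * pi * i.2%:~R * x in if i.1 then cos t else sin t.

Lemma bounded_trig i : bounded_measurable (trig i).
Proof.
have mlin : measurable_fun setT (fun x : T => 2 * pi * i.2%:~R * x).
  exact: measurable_funM.
rewrite /trig; case: i.1; split.
- by apply: (measurableT_comp _ mlin); apply: continuous_measurable_fun;
    exact: continuous_cos.
- by exists 1 => x; exact: cos_max.
- by apply: (measurableT_comp _ mlin); apply: continuous_measurable_fun;
    exact: continuous_sin.
- by exists 1 => x; exact: sin_max.
Qed.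

Variable w : T -> R.
Hypothesis iw : mu.-integrable setT (EFin \o w).
Hypothesis w_trig : forall i, \int[mu]_x (w x * trig i x) = 0.

Local Notation multiplier := (multiplier mu w trig).
Local Notation multiplier_set := (multiplier_set mu w trig).

(** The product formulas express the product of two trigonometric functions as a
combination of two others. *)
Lemma multiplier_trig b : multiplier (trig (b, 1%:Z)).
Proof.
split=> [|k [bk k0]]; first exact: bounded_trig.
split=> [|[b' n]]; first by apply: bounded_measurableM => //; exact: bounded_trig.
have comb i j (c c' : R) :
    (forall x, trig (b, 1%:Z) x * trig (b', n) x = c * trig i x + c' * trig j x) ->
    pairing mu w (fun x => trig (b, 1%:Z) x * k x * trig (b', n) x) = 0.
  move=> E.
  have bt l : bounded_measurable (fun x => k x * trig l x).
    by apply: bounded_measurableM => //; exact: bounded_trig.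
  have bct l (r : R) : bounded_measurable (fun x => r * (k x * trig l x) + 0).
    by apply: bounded_measurableD; [apply: bounded_measurableM => //|];
      exact: bounded_measurable_cst.
  have p0 : pairing mu w (fun=> 0) = 0.
    by rewrite /pairing; under eq_Rintegral do rewrite mulr0; rewrite /Rintegral integral0.
  transitivity (pairing mu w (fun x => c * (k x * trig i x) + (c' * (k x * trig j x) + 0))).
    congr pairing; apply/funext => x; rewrite mulrAC -[_ * k x]mulrC E.
    by rewrite addr0 mulrDr !(mulrCA (k x)).
  rewrite pairing_linear// pairing_linear// ?k0 ?p0 ?mulr0 ?addr0//.
  exact: bounded_measurable_cst.
pose t x : R := 2 * pi * 1%:Z%:~R * x.
pose a x : R := 2 * pi * n%:~R * x.
have aD x : 2 * pi * (1 + n)%:~R * x = t x + a x.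
  by rewrite /t /a intrD mulrDr mulrDl.
have aB x : 2 * pi * (1 - n)%:~R * x = t x - a x.
  by rewrite /t /a intrB mulrBr mulrBl.
case: b b' comb => -[] comb.
- apply: (comb (true, 1 + n) (true, 1 - n) 2^-1 2^-1) => x.
  by rewrite /trig/= aD aB cosD cosB -/(t x) -/(a x); field.
- apply: (comb (false, 1 + n) (false, 1 - n) 2^-1 (- 2^-1)) => x.
  by rewrite /trig/= aD aB sinD sinB -/(t x) -/(a x); field.
- apply: (comb (false, 1 + n) (false, 1 - n) 2^-1 2^-1) => x.
  by rewrite /trig/= aD aB sinD sinB -/(t x) -/(a x); field.
- apply: (comb (true, 1 + n) (true, 1 - n) (- 2^-1) 2^-1) => x.
  by rewrite /trig/= aD aB cosD cosB -/(t x) -/(a x); field.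
Qed.

(** Up to a negligible set this is the indicator of the whole line; it makes up
for the periodicity of the trigonometric functions. *)
Lemma multiplier_set01 : multiplier_set D.
Proof.
have bD : bounded_measurable (\1_D : T -> R).
  by split=> //; exists 1 => x; rewrite indicE; case: (_ \in _); rewrite ?normr1 ?normr0.
split=> // k [bk k0]; split=> [|i]; first exact: bounded_measurableM.
rewrite -[RHS](k0 i); congr fine; apply: ae_eq_integral => //.
- apply: measurable_int (integrable_mul_bounded iw _).
  by do ?[apply: bounded_measurableM => //]; exact: bounded_trig.
- apply: measurable_int (integrable_mul_bounded iw _).
  by apply: bounded_measurableM => //; exact: bounded_trig.
exists (~` D); split=> //; first exact: measurableC.
move=> x /=; apply: contra_not => Dx _.
by rewrite indicE mem_set ?mul1r.
Qed.

Lemma multiplier_trig_gt b t : multiplier_set [set x | t < trig (b, 1%:Z) x].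
Proof. by apply: (multiplier_gt iw bounded_trig); exact: multiplier_trig. Qed.

Lemma multiplier_trig_ge b t : multiplier_set [set x | t <= trig (b, 1%:Z) x].
Proof.
have -> : [set x | t <= trig (b, 1%:Z) x] = ~` [set x | - t < - 1 * trig (b, 1%:Z) x].
  by apply/seteqP; split=> x /=; rewrite mulN1r ltrN2 leNgt => /negP.
apply: (multiplier_setC iw bounded_trig).
apply: (multiplier_gt iw bounded_trig).
by apply: (multiplierZ iw bounded_trig); exact: multiplier_trig.
Qed.

(** On [[0, 1)] the cosine and the sign of the sine determine on which side of a
given point one is. *)
Lemma multiplier_ray t : multiplier_set (`]t, +oo[%classic `&` D).
Proof.
have cE x : trig (true, 1%:Z) x = cos (2 * pi * x) by rewrite /trig/= mulr1.
have sE x : trig (false, 1%:Z) x = sin (2 * pi * x) by rewrite /trig/= mulr1.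
have pi0 : 0 < pi :> R := pi_gt0 R.
have sin_ge (x : R) : 0 <= x <= 2^-1 -> 0 <= sin (2 * pi * x).
  move=> /andP[x0 x2]; apply: sin_ge0_pi; apply/andP; split; nra.
have sin_lt (x : R) : 2^-1 < x < 1 -> sin (2 * pi * x) < 0.
  move=> /andP[x0 x2]; have -> : 2 * pi * x = 2 * pi * (x - 2^-1) + pi by field.
  by rewrite sinDpi oppr_lt0; apply: sin_gt0_pi; apply/andP; split; nra.
have cos_lt (x y : R) : 0 <= x <= 2^-1 -> 0 <= y <= 2^-1 ->
    (cos (2 * pi * x) < cos (2 * pi * y)) = (y < x).
  move=> /andP[x0 x2] /andP[y0 y2]; rewrite ltr_cos.
  - by rewrite ltr_pM2l// mulr_gt0.
  - by rewrite in_itv/=; apply/andP; split; nra.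
  - by rewrite in_itv/=; apply/andP; split; nra.
have cos_refl (x : R) : cos (2 * pi * x) = cos (2 * pi * (1 - x)).
  have -> : 2 * pi * (1 - x) = - (2 * pi * x) + pi *+ 2 by rewrite mulr2n; ring.
  by rewrite cosD2pi cosN.
have [t0|t0] := ltP t 0.
  rewrite (_ : _ `&` _ = D); first exact: multiplier_set01.
  apply/seteqP; split=> x /=; rewrite !in_itv/= andbT; first by case.
  by move=> /andP[x0 x1]; rewrite (lt_le_trans t0 x0) x0 x1.
have [t1|t1] := leP 1 t.
  rewrite (_ : _ `&` _ = set0); first exact: (multiplier_set0 iw bounded_trig).
  apply/seteqP; split=> x //=; rewrite !in_itv/= andbT => -[tx /andP[_ x1]].
  by move: (lt_trans tx x1); rewrite ltNge t1.
have [t2|t2] := leP t 2^-1.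
  rewrite (_ : _ `&` _ = ~` ([set x | 0 <= trig (false, 1%:Z) x] `&`
      [set x | cos (2 * pi * t) <= trig (true, 1%:Z) x]) `&` D).
    apply: multiplier_setI; last exact: multiplier_set01.
    apply: (multiplier_setC iw bounded_trig).
    by apply: multiplier_setI; exact: multiplier_trig_ge.
  apply/seteqP; split=> x /=; rewrite !in_itv/= andbT => -[h /andP[x0 x1]].
    split; last by rewrite x0 x1.
    rewrite sE cE => -[s0]; have [x2|x2] := leP x 2^-1.
      by rewrite leNgt cos_lt ?h// ?x0 ?x2 ?t0 ?t2.
    by move: s0; rewrite leNgt sin_lt// x2 x1.
  split; last by rewrite x0 x1.
  rewrite ltNge; apply/negP => xt; apply: h; rewrite sE cE.
  have x2 : x <= 2^-1 by exact: le_trans xt t2.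
  by rewrite sin_ge ?x0 ?x2// leNgt cos_lt ?x0 ?x2 ?t0 ?t2// -leNgt.
rewrite (_ : _ `&` _ = ~` [set x | 0 <= trig (false, 1%:Z) x] `&`
    [set x | cos (2 * pi * t) < trig (true, 1%:Z) x] `&` D).
  apply: multiplier_setI; last exact: multiplier_set01.
  apply: multiplier_setI; last exact: multiplier_trig_gt.
  apply: (multiplier_setC iw bounded_trig); exact: multiplier_trig_ge.
have half (y : R) : 2^-1 < y < 1 -> 0 <= 1 - y <= 2^-1.
  by move=> /andP[y0 y1]; apply/andP; split; lra.
apply/seteqP; split=> x /=; rewrite !in_itv/= andbT.
  move=> [tx /andP[x0 x1]]; have x2 : 2^-1 < x by exact: lt_trans tx.
  split; last by rewrite x0 x1.
  rewrite sE cE; split; first by apply/negP; rewrite -ltNge sin_lt// x2 x1.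
  by rewrite (cos_refl t) (cos_refl x) cos_lt ?half ?x2 ?t2//; lra.
move=> [[s0 ct] /andP[x0 x1]]; split; last by rewrite x0 x1.
have x2 : 2^-1 < x.
  by rewrite ltNge; apply/negP => x2; apply: s0; rewrite sE sin_ge// x0 x2.
move: ct; rewrite cE (cos_refl t) (cos_refl x) cos_lt ?half ?x2 ?t2//; lra.
Qed.

Lemma multiplier_measurable E : measurable E -> multiplier_set (E `&` D).
Proof.
move=> mE; have : <<s @RGenOInfty.G R >> E.
  have : (@RGenOInfty.G R).-sigma.-measurable E by rewrite -RGenOInfty.measurableE.
  by [].
apply: (@smallest_sub _ _ _ [set E | multiplier_set (E `&` D)]); last first.
  by move=> _ [t ->]; exact: multiplier_ray.
split.
- by rewrite /= set0I; exact: (multiplier_set0 iw bounded_trig).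
- move=> A MA /=; rewrite setTD.
  rewrite (_ : ~` A `&` D = ~` (A `&` D) `&` D).
    apply: (multiplier_setI); last exact: multiplier_set01.
    exact: (multiplier_setC iw bounded_trig).
  by rewrite setCI setIUl setICl setU0.
- move=> A MA /=; rewrite setI_bigcupl.
  exact: (multiplier_bigcup iw bounded_trig).
Qed.

(** The integral of [w] over every Borel subset of [[0, 1)] vanishes, in
particular over the sets where [w] is positive and where it is negative. *)
Theorem fourier_unique : {ae mu, forall x, w x = 0}.
Proof.
have w1 : annihilated mu w trig (fun=> 1).
  split=> [|i]; first exact: bounded_measurable_cst.
  by rewrite /pairing; under eq_Rintegral do rewrite mul1r; exact: w_trig.
have w0 E : measurable E -> \int[mu]_x (w x * \1_(E `&` D) x) = 0.
  move=> /multiplier_measurable[_ /(_ _ w1)[_ /(_ (true, 0)) h]].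
  rewrite -[RHS]h; congr Rintegral; apply/funext => x.
  by rewrite /trig /= mulr0 mul0r cos0 !mulr1.
have mw : measurable_fun setT w by apply/measurable_EFinP; exact: measurable_int iw.
have ae0 E (c : R) : measurable E -> `|c| = 1 -> (forall x, E x -> 0 <= c * w x) ->
    {ae mu, forall x, w x * \1_(E `&` D) x = 0}.
  move=> mE c1 cw; pose f x := w x * \1_(E `&` D) x.
  have mf : measurable_fun setT f.
    by apply: measurable_funM => //; apply: measurable_indic; exact: measurableI.
  have bf : bounded_measurable (\1_(E `&` D) : T -> R).
    split; first by apply: measurable_indic; exact: measurableI.
    by exists 1 => x; rewrite indicE; case: (_ \in _); rewrite ?normr1 ?normr0.
  have i0 : (\int[mu]_x `|(f x)%:E| = 0)%E.
    transitivity (\int[mu]_x (c%:E * (f x)%:E))%E.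
      apply: eq_integral => x _; rewrite /f -EFinM/=; congr EFin.
      rewrite indicE; have [/set_mem[Ex _]|_] := boolP (x \in _); last by rewrite !mulr0 normr0.
      by rewrite !mulr1 -[LHS]mul1r -c1 -normrM ger0_norm ?cw.
    have intf : mu.-integrable setT (EFin \o f) by exact: (integrable_mul_bounded iw bf).
    rewrite (integralZl measurableT intf).
    have /fineK <- := integrable_fin_num measurableT intf.
    by rewrite -[fine _]/(\int[mu]_x (w x * \1_(E `&` D) x)) w0// mule0.
  have /(ae_eq_integral_abs mu measurableT) : measurable_fun setT (EFin \o f).
    exact/measurable_EFinP.
  by move=> [/(_ i0) h _]; apply: filterS h => x /(_ I)[].
have mp : measurable [set x | 0 < w x].
  by rewrite -[X in measurable X]setTI; exact: measurable_fun_ltr.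
have mn : measurable [set x | w x < 0].
  by rewrite -[X in measurable X]setTI; exact: measurable_fun_ltr.
have wp := ae0 _ 1 mp (normr1 _) (fun x (wx : 0 < w x) => ltac:(by rewrite mul1r ltW)).
have wn := ae0 _ (-1) mn (normrN1 _) (fun x (wx : w x < 0) => ltac:(by rewrite mulN1r oppr_ge0 ltW)).
have wD : {ae mu, forall x, D x}.
  by exists (~` D); split=> //; exact: measurableC.
apply: filterS3 wp wn wD => x; rewrite !indicE => p n Dx.
have [w_lt|w_gt|//] := ltgtP (w x) 0.
  by move: n; rewrite mem_set ?mulr1.
by move: p; rewrite mem_set ?mulr1.
Qed.

End fourier_uniqueness.

(** * Comparing the L2 spaces of two measures *)

Section restriction.
Context d (T : measurableType d) (R : realType).
Variables (m m' : {measure set T -> \bar R}) (K : R).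
Hypothesis K0 : 0 < K.
Hypothesis mm' : forall E, measurable E -> (m' E <= K%:E * m E)%E.

Lemma le_integral_dominated (f : T -> \bar R) : (forall x, (0 <= f x)%E) ->
  measurable_fun setT f -> (\int[m']_x f x <= K%:E * \int[m]_x f x)%E.
Proof.
move=> f0 mf; pose k := NngNum (ltW K0).
have -> : (K%:E * \int[m]_x f x = \int[mscale k m]_x f x)%E.
  by rewrite ge0_integral_mscale.
by apply: ge0_le_measure_integral => // E mE; exact: mm'.
Qed.

Lemma ae_dominated (P : T -> Prop) :
  {ae m, forall x, P x} -> {ae m', forall x, P x}.
Proof.
move=> [N [mN N0 NP]]; exists N; split=> //; apply/eqP.
by rewrite eq_le measure_ge0 andbT (le_trans (mm' mN))// N0 mule0.
Qed.

Lemma sqint_dominated (u : sqintType m) : (u : T -> R[i]) \in sqint m'.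
Proof.
apply/asboolP; split; [exact: sqint_measurableRe|exact: sqint_measurableIm|].
apply: le_lt_trans (le_integral_dominated _ _) _.
- by move=> x; rewrite lee_fin sqr_ge0.
- by apply: measurable_normc2; [exact: sqint_measurableRe|exact: sqint_measurableIm].
- by rewrite -(fineK (sqint_fin u)) -EFinM ltry.
Qed.

(** The identity on functions descends to classes, null sets of [m] being null for
[m']. *)
Definition L2restr (u : L2 m) : L2 m' := L2class (SqInt (sqint_dominated (L2repr u))).

Lemma L2restr_class (u : sqintType m) (v : sqintType m') : u =1 v ->
  L2restr (L2class u) = L2class v.
Proof.
move=> uv; apply/L2class_eq.
by apply: filterS (ae_dominated (L2repr_class u)) => x /= ->; rewrite uv.
Qed.

Lemma L2restr_linear a (u v : L2 m) :
  L2restr (a *: u + v) = a *: L2restr u + L2restr v.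
Proof.
rewrite /L2restr -[a *: L2class _]/(L2scale _ _) L2scale_class -L2classD.
have -> : a *: u + v = L2class (a *: L2repr u + L2repr v).
  by rewrite L2classD L2class_repr -[L2class _]/(L2scale a u).
exact: L2restr_class.
Qed.

Lemma hnorm_L2restr (u : L2 m) :
  hnorm (L2form m') (L2restr u) ^+ 2 <= K * hnorm (L2form m) u ^+ 2.
Proof.
rewrite -lee_fin [leRHS]EFinM /L2restr hnorm_L2class hnorm_L2; apply: le_integral_dominated.
- by move=> x; rewrite lee_fin sqr_ge0.
- by apply: measurable_normc2; [exact: sqint_measurableRe|exact: sqint_measurableIm].
Qed.

Lemma hnorm_L2restr_le (u : L2 m) :
  hnorm (L2form m') (L2restr u) <= Num.sqrt K * hnorm (L2form m) u.
Proof.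
rewrite -ler_sqr ?nnegrE ?mulr_ge0 ?sqrtr_ge0 ?hnorm_ge0//.
by rewrite exprMn (sqr_sqrtr (ltW K0)); exact: hnorm_L2restr.
Qed.

Lemma L2restrB (u v : L2 m) : L2restr (u - v) = L2restr u - L2restr v.
Proof. by rewrite addrC -scaleN1r L2restr_linear scaleN1r addrC. Qed.

Lemma L2restr_comb (f : nat -> L2 m) c N :
  L2restr (nat_comb f c N) = nat_comb (L2restr \o f) c N.
Proof.
have r0 : L2restr 0 = 0.
  have := L2restr_linear (-1) 0 0.
  by rewrite scaler0 addr0 scaleN1r addNr.
elim: N => [|N IH]; first by rewrite /nat_comb !big_ord0.
rewrite /nat_comb !big_ord_recr/= addrC L2restr_linear addrC; congr (_ + _).
exact: IH.
Qed.

End restriction.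

(** * The exponentials *)

Section exponentials_L2.
Context (R : realType).
Local Notation T := (measurableTypeR R).
Local Notation D := (`[0%R, 1%R[%classic : set T).

Lemma fourier_restr (m m' : {finite_measure set T -> \bar R}) (K : R)
  (mm' : forall E, measurable E -> (m' E <= K%:E * m E)%E) (K0 : 0 < K) n :
  L2restr K0 mm' (fourier m n) = fourier m' n.
Proof. exact: L2restr_class. Qed.

Lemma fourier_fun_conj n (x : T) : (fourier_fun n x)^* = fourier_fun (- n) x.
Proof.
rewrite /fourier_fun intrN mulrN mulNr /expi cosN sinN.
by rewrite -[LHS]/(conjc _).
Qed.

Lemma fourier_funM m n (x : T) :
  fourier_fun m x * fourier_fun n x = fourier_fun (m + n) x.
Proof.
have e : 2 * pi * (m + n)%:~R * x = 2 * pi * m%:~R * x + 2 * pi * n%:~R * x :> R.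
  by rewrite intrD mulrDr mulrDl.
rewrite /fourier_fun e /expi cosD sinD.
by apply/eqP; rewrite eq_complex /=; apply/andP; split; apply/eqP; ring.
Qed.

(** The coefficients of index [n] and [- n] together give the integrals of the real
and imaginary parts against the cosine and the sine. *)
Lemma fourier_total (mu : {finite_measure set T -> \bar R}) :
  mu (~` D) = 0%E -> forall u : L2 mu,
  (forall n, L2dot mu u (fourier mu n) = 0) -> u = 0.
Proof.
move=> mu01 u u0.
pose a x := Re (L2repr u x); pose b x := Im (L2repr u x).
have L1 (f : T -> R) : f \in Lfun mu 2%:E -> mu.-integrable setT (EFin \o f).
  move=> f2; apply/Lfun1_integrable/Lfun_subset12 => //.
  exact: fin_num_measure.
have /sqintP[/L1 ia /L1 ib] := valP (L2repr u).
have key n : [/\ \int[mu]_x (a x * trig (true, n) x) = 0,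
                 \int[mu]_x (a x * trig (false, n) x) = 0,
                 \int[mu]_x (b x * trig (true, n) x) = 0 &
                 \int[mu]_x (b x * trig (false, n) x) = 0].
  have ibt f i : mu.-integrable setT (EFin \o f) ->
      mu.-integrable setT (EFin \o (fun x => f x * trig i x)).
    by move=> if_; apply: (integrable_mul_bounded if_); exact: bounded_trig.
  have E k : \int[mu]_x (a x * trig (true, k) x) + \int[mu]_x (b x * trig (false, k) x) = 0
    /\ \int[mu]_x (b x * trig (true, k) x) - \int[mu]_x (a x * trig (false, k) x) = 0.
    have := u0 k; rewrite -{1}(L2class_repr u) L2dot_class /cintegral => -[e1 e2].
    split.
      rewrite -RintegralD//; [|exact: ibt..].
      rewrite -[RHS]e1; congr Rintegral; apply/funext => x.
      by rewrite /a /b /fourier_fun /expi /trig/=; case: (L2repr u x) => p q /=; ring.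
    rewrite -RintegralB//; [|exact: ibt..].
    rewrite -[RHS]e2; congr Rintegral; apply/funext => x.
    by rewrite /a /b /fourier_fun /expi /trig/=; case: (L2repr u x) => p q /=; ring.
  have cosNn f : \int[mu]_x (f x * trig (true, - n) x) = \int[mu]_x (f x * trig (true, n) x).
    congr Rintegral; apply/funext => x; rewrite /trig/=.
    by rewrite intrN mulrN mulNr cosN.
  have sinNn f : mu.-integrable setT (EFin \o f) ->
      \int[mu]_x (f x * trig (false, - n) x) = - \int[mu]_x (f x * trig (false, n) x).
    move=> if_; rewrite -[RHS]mulN1r -RintegralZl//; last exact: ibt.
    congr Rintegral; apply/funext => x; rewrite /trig/=.
    by rewrite intrN mulrN mulNr sinN mulN1r mulrN.
  have [e1 e2] := E n; have [e3 e4] := E (- n).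
  rewrite !cosNn !sinNn// in e3 e4.
  by split; lra.
have az : {ae mu, forall x, a x = 0}.
  by apply: fourier_unique => // -[[] n]; have [] := key n.
have bz : {ae mu, forall x, b x = 0}.
  by apply: fourier_unique => // -[[] n]; have [] := key n.
rewrite -(L2class_repr u) -[RHS]L2class0; apply/L2class_eq.
apply: filterS2 az bz => x; rewrite /a /b /=.
by case: (L2repr u x) => ? ? /= -> ->.
Qed.

Lemma measurable01 : measurable D.
Proof. exact: measurable_itv. Qed.

Lemma lebesgue01_lty : (@lebesgue_measure R D < +oo)%E.
Proof. by rewrite lebesgue_measure_itv/= lte_fin ltr01 ltry. Qed.

Definition lebesgue01 : {finite_measure set T -> \bar R} :=
  @mfrestr _ T R D (@lebesgue_measure R) measurable01 lebesgue01_lty.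

Lemma lebesgue01E A : lebesgue01 A = @lebesgue_measure R (A `&` D).
Proof. by []. Qed.

Lemma lebesgue01C : lebesgue01 (~` D) = 0%E.
Proof. by rewrite lebesgue01E setICl measure0. Qed.

Lemma lebesgue01T : lebesgue01 setT = 1%E.
Proof.
by rewrite lebesgue01E setTI lebesgue_measure_itv/= lte_fin ltr01 sube0.
Qed.

Lemma integral_lebesgue01 (f : T -> R) :
  lebesgue01.-integrable setT (EFin \o f) ->
  (\int[lebesgue01]_x (f x)%:E = \int[@lebesgue_measure R]_(x in D) (f x)%:E)%E.
Proof.
move=> if_.
rewrite (negligible_integral (measurableC measurable01) measurableT if_ lebesgue01C).
rewrite setTD setCK; apply: eq_measure_integral => A mA AD.
by rewrite [LHS]lebesgue01E setIidl.
Qed.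

Lemma expi_period n : expi (2 * pi * n%:~R) = 1 :> R[i].
Proof.
have nat_period (k : nat) : cos (2 * pi * k%:R) = 1 :> R /\ sin (2 * pi * k%:R) = 0 :> R.
  have -> : 2 * pi * k%:R = 0 + (pi *+ 2) *+ k :> R.
    by rewrite add0r -[RHS]mulr_natr -(mulr_natl pi 2).
  by rewrite (periodicn (@cosD2pi R)) (periodicn (@sinD2pi R)) cos0 sin0.
case: n => k; first by have [c s] := nat_period k; rewrite /expi c s.
by rewrite NegzE intrN mulrN /expi cosN sinN; have [-> ->] := nat_period k.+1; rewrite oppr0.
Qed.

(** The primitives of nonconstant trigonometric functions are periodic. *)
Lemma Rintegral_trig01 i : i.2 != 0 -> \int[lebesgue01]_x trig i x = 0.
Proof.
case: i => b n /= n0; rewrite -[n != 0]/((n : int) != 0) in n0.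
pose K : R := 2 * pi * n%:~R.
have K0 : K != 0 by rewrite !mulf_neq0 ?intr_eq0 ?pnatr_eq0// gt_eqF ?pi_gt0.
have [mt bt] := bounded_trig R (b, n).
have itr : lebesgue01.-integrable setT (EFin \o trig (b, n)).
  apply: measurable_bounded_integrable => //.
    by rewrite -ge0_fin_numE// fin_num_measure.
  have [C tC] := bt; exists C; split; first exact: num_real.
  by move=> M CM x _; exact: le_trans (tC x) (ltW CM).
rewrite /Rintegral integral_lebesgue01//.
rewrite integral_itv_bndo_bndc; last first.
  by apply/measurable_EFinP; apply: measurable_funS mt.
pose F (x : R) := if b then K^-1 * sin (K * x) else - K^-1 * cos (K * x).
have dF (x : R) : is_derive x 1 F (trig (b, n) x).
  have dK : is_derive x 1 (fun x : R => K * x) K.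
    rewrite -[X in is_derive _ _ _ X](mulr1 K).
    exact: is_deriveZ.
  rewrite /F /trig/= -/K; case: (b).
    have -> : cos (K * x) = K^-1 *: (cos (K * x) * K).
      by rewrite /GRing.scale/= mulrCA mulVf ?mulr1.
    apply: is_deriveZ; exact: (is_derive1_comp (is_derive_sin (K * x)) dK).
  have -> : sin (K * x) = (- K^-1) *: (- sin (K * x) * K).
    by rewrite /GRing.scale/=; field.
  apply: is_deriveZ; exact: (is_derive1_comp (is_derive_cos (K * x)) dK).
have cF : continuous F.
  by move=> x; apply/differentiable_continuous/derivable1_diffP; case: (dF x).
rewrite (@continuous_FTC2 _ _ F 0 1)//.
- have := expi_period n; rewrite -/K /expi => -[c1 s1].
  by rewrite /F mulr1 mulr0 c1 s1 cos0 sin0 subee//; case: (b).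
- apply: continuous_subspaceT => x; rewrite /trig -/K.
  have cK : {for x, continuous (fun x : R => K * x)} by apply: mulrl_continuous.
  case: (b) => /=; apply: continuous_comp => //; first exact: continuous_cos.
  exact: continuous_sin.
- split; first by move=> x _; case: (dF x).
  + by apply: cvg_at_right_filter; exact: cF.
  + by apply: cvg_at_left_filter; exact: cF.
- by move=> x _; rewrite derive1E; have [_ ->] := dF x.
Qed.

Lemma fourier01_orthonormal m n :
  L2dot lebesgue01 (fourier lebesgue01 m) (fourier lebesgue01 n) = (m == n)%:R.
Proof.
rewrite L2dot_class.
rewrite (_ : (fun x => _) = fourier_fun (m - n)); last first.
  by apply/funext => x; rewrite /= fourier_fun_conj fourier_funM.
rewrite -subr_eq0; have [->|mn] := eqVneq (m - n) 0.
  have -> : fourier_fun 0 = (fun=> 1 : R[i]).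
    by apply/funext => x; rewrite /fourier_fun mulr0 mul0r /expi cos0 sin0.
  have cst (r : R) : \int[lebesgue01]_(x in setT) r = r.
    transitivity (r * fine (lebesgue01 setT)); first exact: Rintegral_cst.
    by rewrite lebesgue01T mulr1.
  by rewrite /cintegral /= !cst.
rewrite /cintegral.
have -> := @Rintegral_trig01 (true, m - n) mn.
by have -> := @Rintegral_trig01 (false, m - n) mn.
Qed.

End exponentials_L2.

(** * The operators carrying exponentials to an orthonormal basis *)

Section finite_measure_sum.
Context d (T : measurableType d) (R : realType).
Variables m1 m2 : {finite_measure set T -> \bar R}.

Definition fmeasure_add := measure_add m1 m2.

HB.instance Definition _ := Measure.on fmeasure_add.

Lemma fmeasure_addE E : fmeasure_add E = (m1 E + m2 E)%E.
Proof. exact: measure_addE. Qed.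

Let fmeasure_add_fin : fin_num_fun fmeasure_add.
Proof. by move=> E mE; rewrite fmeasure_addE fin_numD !fin_num_measure. Qed.

HB.instance Definition _ :=
  Measure_isFinite.Build _ _ _ fmeasure_add fmeasure_add_fin.

End finite_measure_sum.

Section characterizations.
Context (R : realType).
Local Notation T := (measurableTypeR R).
Local Notation D := (`[0%R, 1%R[%classic : set T).
Local Notation nu := (lebesgue01 R).
Local Notation fnu := (fourier nu \o zof).

Lemma fnu_orthonormal : orthonormal_family (L2form nu) fnu.
Proof.
move=> m n; rewrite [LHS]fourier01_orthonormal.
by rewrite (inj_eq (can_inj int_of_nat_codeK)).
Qed.

Section dominated.
Variables (mu : {finite_measure set T -> \bar R}) (K : R).
Hypothesis mu01 : mu (~` D) = 0%E.
Hypothesis K0 : 0 < K.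
Hypothesis nuK : forall E, measurable E -> (nu E <= K%:E * mu E)%E.
Local Notation fmu := (fourier mu \o zof).
Local Notation dot := (L2form mu).
Local Notation restr := (L2restr K0 nuK).

Lemma restr_fmu : restr \o fmu = fnu.
Proof. by apply/funext => k /=; exact: fourier_restr. Qed.

(** The sum of the squared coefficients is the squared norm in L2 of Lebesgue
measure. *)
Lemma riesz_fischer_dominated : riesz_fischer dot (fourier mu).
Proof.
apply/riesz_fischerP; exists K^-1 => [|N c]; first by rewrite invr_gt0.
rewrite ler_pdivrMl// -(hnorm_comb_orthonormal _ _ fnu_orthonormal).
by rewrite -restr_fmu -L2restr_comb; exact: hnorm_L2restr.
Qed.

Lemma fmu_eq0 (u : L2 mu) : (forall k, dot u (fmu k) = 0) -> u = 0.
Proof.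
move=> u0; apply: (fourier_total mu01) => n.
by rewrite -(nat_code_of_intK n); exact: u0.
Qed.

Lemma fmu_total : total_family dot fmu /\ exists2 e, orthonormal_family dot e & total_family dot e.
Proof.
apply: total_of_ortho0; [exact: L2_complete| |exact: fmu_eq0].
exact: riesz_fischer_indep riesz_fischer_dominated.
Qed.

(** Both sides are continuous in [u] and agree on trigonometric polynomials. *)
Lemma dot_operator (B : {linear L2 mu -> L2 mu}) : bounded_operator dot B ->
  orthonormal_family dot (B \o fmu) ->
  forall u k, dot (B u) (B (fmu k)) = L2form nu (restr u) (fnu k).
Proof.
move=> /bounded_operatorP[M M0 BM] Bo u k.
apply/eqP; rewrite -subr_eq0; apply/eqP/Normc.eq0_normc/eqP.
rewrite eq_le normc_ge0 andbT; apply/ler_addgt0Pr => eps eps0; rewrite add0r.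
have L0 : 0 < M + Num.sqrt K by rewrite ltr_pwDl// sqrtr_ge0.
have [N [c uc]] := fmu_total.1 u _ (divr_gt0 eps0 L0).
have Bcomb : B (nat_comb fmu c N) = nat_comb (B \o fmu) c N.
  by rewrite /nat_comb linear_sum; apply: eq_bigr => i _; rewrite linearZ.
have -> : dot (B u) (B (fmu k)) - L2form nu (restr u) (fnu k) =
    dot (B (u - nat_comb fmu c N)) (B (fmu k)) -
    L2form nu (restr (u - nat_comb fmu c N)) (fnu k).
  rewrite L2restrB linearB/= !linearBl/= L2restr_comb restr_fmu Bcomb.
  rewrite (dot_comb_orthonormal _ _ _ fnu_orthonormal) (dot_comb_orthonormal _ _ _ Bo).
  by rewrite opprB addrA subrK.
have norm1 (V : lmodType R[i]) (dt : {dot V for (Num.conj : R[i] -> R[i])}) (e : nat -> V) :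
    orthonormal_family dt e -> hnorm dt (e k) = 1.
  by move=> eo; rewrite /hnorm eo eqxx/= sqrtr1.
apply: le_trans (le_normcD _ _) _; rewrite normcN.
apply: le_trans (lerD (cauchy_schwarz _ _ _) (cauchy_schwarz _ _ _)) _.
rewrite (norm1 _ _ _ fnu_orthonormal) (norm1 _ _ _ Bo) !mulr1.
apply: le_trans (lerD (BM _) (hnorm_L2restr_le K0 nuK _)) _.
by rewrite -mulrDl -ler_pdivlMl// mulrC ltW.
Qed.

(** The coefficients of [B u] along an orthonormal basis are prescribed to be the
Fourier coefficients of the restriction of [u], which are square-summable by
Bessel's inequality. *)
Lemma operator_exists : exists B : {linear L2 mu -> L2 mu},
  bounded_operator dot B /\ orthonormal_basis dot (B \o fourier mu).
Proof.
have [_ [e eo et]] := fmu_total.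
have /choice[B BP] : forall u, exists v,
    (forall k, dot v (e k) = L2form nu (restr u) (fnu k)) /\
    hnorm dot v <= Num.sqrt K * hnorm dot u.
  move=> u; have [v [vc vn _]] := orthonormal_expansion
    (c := fun k => L2form nu (restr u) (fnu k)) (@L2_complete _ _ _ mu) eo
    (fun N => bessel (restr u) N fnu_orthonormal).
  exists v; split=> //; apply: le_trans (hnorm_L2restr_le K0 nuK u).
  by rewrite -ler_sqr ?nnegrE ?hnorm_ge0.
have eI u v : (forall k, dot u (e k) = dot v (e k)) -> u = v.
  move=> uv; apply/eqP; rewrite -subr_eq0; apply/eqP/(total_eq0 et) => k.
  by rewrite linearBl/= uv subrr.
have [B' B'E] : exists B' : {linear L2 mu -> L2 mu}, B' =1 B.
  apply: linear_pack => a u v; apply: eI => k.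
  have [BD _] := BP (a *: u + v); have [Bu _] := BP u; have [Bv _] := BP v.
  by rewrite BD L2restr_linear !linearDl/= !linearZl_LR/= Bu Bv.
have Be : (B' \o fourier mu) \o zof = e.
  apply/funext => n; apply: eI => k /=; rewrite B'E (BP _).1 eo.
  by rewrite -fnu_orthonormal; congr (L2form nu _ _); exact: fourier_restr.
exists B'; split; last by apply/orthonormal_basisP; rewrite Be.
apply/bounded_operatorP; exists (Num.sqrt K); first by rewrite sqrtr_gt0.
by move=> u; rewrite B'E; have [_] := BP u.
Qed.

End dominated.

Section necessity.
Variable mu : {finite_measure set T -> \bar R}.
Hypothesis mu01 : mu (~` D) = 0%E.
Local Notation dot := (L2form mu).

(** A combination of the exponentials is sent to a vector whose norm is the l2 norm
of the coefficients. *)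
Lemma riesz_fischer_operator (B : {linear L2 mu -> L2 mu}) :
  bounded_operator dot B -> orthonormal_basis dot (B \o fourier mu) ->
  riesz_fischer dot (fourier mu).
Proof.
move=> /bounded_operatorP[M M0 BM] /orthonormal_basisP[Bo _].
apply/riesz_fischerP; exists (M ^- 2) => [|N c]; first by rewrite invr_gt0 exprn_gt0.
rewrite ler_pdivrMl ?exprn_gt0// -(hnorm_comb_orthonormal _ _ Bo) -exprMn.
rewrite ler_sqr ?nnegrE ?mulr_ge0 ?hnorm_ge0 ?(ltW M0)//.
apply: le_trans (BM _); rewrite le_eqVlt; apply/orP; left; apply/eqP; congr hnorm.
by rewrite /nat_comb linear_sum; apply: eq_bigr => i _; rewrite linearZ.
Qed.

Lemma indic_sqint (m : {finite_measure set T -> \bar R}) (E : set T) :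
  measurable E -> (fun x => (\1_E x)%:C : R[i]) \in sqint m.
Proof.
move=> mE; apply/asboolP; split => /=; [exact: measurable_indic|exact: measurable_cst|].
rewrite (_ : (fun x => _) = fun x => (\1_E x)%:E).
  by rewrite integral_indic// setIT -ge0_fin_numE// fin_num_measure.
apply/funext => x; congr EFin.
by rewrite expr0n addr0 sqrtr_sqr indicE; case: (_ \in _); rewrite ?normr1 ?normr0 ?expr1n ?expr0n.
Qed.

Definition L2indic (m : {finite_measure set T -> \bar R}) E (mE : measurable E) : L2 m :=
  L2class (SqInt (indic_sqint m mE)).

Lemma hnorm_L2indic (m : {finite_measure set T -> \bar R}) E (mE : measurable E) :
  ((hnorm (L2form m) (L2indic m mE) ^+ 2)%:E = m E)%E.
Proof.
rewrite hnorm_L2class -[in RHS](setIT E) -integral_indic//; apply: eq_integral => x _.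
congr EFin => /=.
by rewrite expr0n addr0 sqrtr_sqr indicE; case: (_ \in _); rewrite ?normr1 ?normr0 ?expr1n ?expr0n.
Qed.

(** The inequality between norms passes to limits in L2 of [mu + nu], where
trigonometric polynomials are dense; it is then applied to indicators. *)
Lemma dominated_riesz_fischer : riesz_fischer dot (fourier mu) ->
  exists2 K : R, 0 < K & forall E, measurable E -> (nu E <= K%:E * mu E)%E.
Proof.
move=> /riesz_fischerP[A A0 muA].
pose m : {finite_measure set T -> \bar R} := fmeasure_add mu nu.
have mE E : m E = (mu E + nu E)%E by exact: fmeasure_addE.
have m01 : m (~` D) = 0%E by rewrite mE mu01 lebesgue01C adde0.
have lt01 : (0 : R) < 1 by [].
have num E : measurable E -> (nu E <= 1%:E * m E)%E by move=> ?; rewrite mul1e mE leeDr.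
have mum E : measurable E -> (mu E <= 1%:E * m E)%E by move=> ?; rewrite mul1e mE leeDl.
have [mt _] := fmu_total m01 lt01 num.
exists A^-1; first by rewrite invr_gt0.
move=> E mE'; pose u := L2indic m mE'.
pose R1 := L2restr lt01 num; pose R2 := L2restr lt01 mum.
have R1u : R1 u = L2indic nu mE' by exact: L2restr_class.
have R2u : R2 u = L2indic mu mE' by exact: L2restr_class.
have le1 v : hnorm (L2form nu) (R1 v) <= hnorm (L2form m) v.
  by have := hnorm_L2restr_le lt01 num v; rewrite sqrtr1 mul1r.
have le2 v : hnorm (L2form mu) (R2 v) <= hnorm (L2form m) v.
  by have := hnorm_L2restr_le lt01 mum v; rewrite sqrtr1 mul1r.
pose a := Num.sqrt A^-1.
have a0 : 0 < a by rewrite sqrtr_gt0 invr_gt0.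
have aA : a ^+ 2 = A^-1 by rewrite sqr_sqrtr// invr_ge0 ltW.
suff main : hnorm (L2form nu) (R1 u) <= a * hnorm (L2form mu) (R2 u).
  rewrite -(hnorm_L2indic nu mE') -(hnorm_L2indic mu mE') -R1u -R2u -EFinM lee_fin.
  rewrite -aA -exprMn ler_sqr ?nnegrE ?hnorm_ge0//.
  by rewrite mulr_ge0 ?hnorm_ge0// ltW.
apply/ler_addgt0Pr => eps eps0.
have a1 : 0 < a + 1 by rewrite ltr_wpDl// ltW.
have [N [c uc]] := mt u _ (divr_gt0 eps0 a1).
set p := nat_comb _ _ _ in uc.
have R1B v w : R1 (v - w) = R1 v - R1 w by exact: L2restrB.
have R2B v w : R2 (v - w) = R2 v - R2 w by exact: L2restrB.
have pp : hnorm (L2form nu) (R1 p) <= a * hnorm (L2form mu) (R2 p).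
  rewrite /R1 /R2 /p !L2restr_comb restr_fmu.
  have -> : L2restr lt01 mum \o (fourier m \o zof) = fourier mu \o zof.
    by apply/funext => k /=; exact: fourier_restr.
  rewrite -ler_sqr ?nnegrE ?mulr_ge0 ?hnorm_ge0 ?(ltW a0)//.
  rewrite exprMn (hnorm_comb_orthonormal _ _ fnu_orthonormal) aA.
  by rewrite -ler_pdivrMl ?invr_gt0// invrK; exact: muA.
have b1 := le1 (u - p); rewrite R1B in b1.
have b2 := le2 (p - u); rewrite R2B hnorm_distC in b2.
have t1 := hnorm_dist_triangle (L2form nu) (R1 u) (R1 p) 0; rewrite !subr0 in t1.
have t2 := hnorm_dist_triangle (L2form mu) (R2 p) (R2 u) 0; rewrite !subr0 in t2.
have uc' : hnorm (L2form m) (u - p) * (a + 1) < eps by rewrite -ltr_pdivlMr.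
rewrite (hnorm_distC _ p u) hnorm_distC in b2.
have h : a * hnorm (L2form mu) (R2 p) <=
    a * (hnorm (L2form m) (u - p) + hnorm (L2form mu) (R2 u)).
  by rewrite ler_pM2l//; lra.
lra.
Qed.

End necessity.
End characterizations.

(** * Densities and comparison of measures *)

Section density.
Context (R : realType).
Local Notation T := (measurableTypeR R).
Local Notation D := (`[0%R, 1%R[%classic : set T).
Local Notation la := (@lebesgue_measure R).
Local Notation nu := (lebesgue01 R).

Lemma measureD_null d' (T' : measurableType d') (m : {measure set T' -> \bar R})
  (A N : set T') : measurable A -> measurable N -> m N = 0%E -> m (A `\` N) = m A.
Proof.
move=> mA mN N0; apply/eqP; rewrite eq_le le_measure ?inE//=; last exact: measurableD.
apply: (@le_trans _ _ (m (A `\` N `|` N))).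
  apply: le_measure; rewrite ?inE//; first by apply: measurableU => //; exact: measurableD.
  by move=> x Ax; have [|] := pselect (N x); [right|left].
apply: le_trans (measureU2 m (measurableD mA mN) mN) _.
rewrite -[leRHS]adde0; apply: leeD; first exact: lexx.
by rewrite -N0; exact: lexx.
Qed.

Variables (mu mua mus : {finite_measure set T -> \bar R}) (N : set T).
Hypothesis mu01 : mu (~` D) = 0%E.
Hypothesis mN : measurable N.
Hypothesis laN : la N = 0%E.
Hypothesis musN : mus (~` N) = 0%E.
Hypothesis mu_sum : forall A, measurable A -> mu A = (mua A + mus A)%E.
Hypothesis mua_la : forall A, measurable A -> la A = 0%E -> mua A = 0%E.
Variables (r g : T -> \bar R).
Hypothesis ir : la.-integrable setT r.
Hypothesis mua_r : forall A, measurable A -> (mua A = \int[la]_(x in A) r x)%E.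
Hypothesis gr : {ae la, forall x, g x = r x}.

Lemma la01_lty E : measurable E -> E `<=` D -> (la E < +oo)%E.
Proof.
move=> mE ED; apply: le_lt_trans (lebesgue01_lty R).
by apply: le_measure; rewrite ?inE//; exact: measurable01.
Qed.

Lemma integrable_cst01 E (c : R) : measurable E -> E `<=` D ->
  la.-integrable E (cst c%:E).
Proof.
move=> mE ED; apply/integrableP; split; first exact: measurable_cst.
rewrite [X in (X < _)%E](_ : _ = \int[la]_(x in E) cst `|c|%:E x)%E//.
rewrite integral_cst//; apply: lte_mul_pinfty => //; exact: la01_lty.
Qed.

Lemma density_le E (c : R) : measurable E -> E `<=` D ->
  (forall x, E x -> r x <= c%:E)%E -> (mua E <= c%:E * la E)%E.
Proof.
move=> mE ED rc; rewrite mua_r// -integral_cst//; apply: le_integral => //.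
- exact: integrableS ir.
- exact: integrable_cst01.
- by move=> x /set_mem /rc.
Qed.

Lemma density_ge E (c : R) : measurable E -> E `<=` D ->
  (forall x, E x -> c%:E <= r x)%E -> (c%:E * la E <= mua E)%E.
Proof.
move=> mE ED rc; rewrite mua_r// -integral_cst//; apply: le_integral => //.
- exact: integrable_cst01.
- exact: integrableS ir.
- by move=> x /set_mem /rc.
Qed.

(** Removing a set that carries the singular part leaves the absolutely continuous
part, for which that set is null. *)
Lemma mu_setDN E : measurable E -> mu (E `\` N) = mua E.
Proof.
move=> mE; have mEN : measurable (E `\` N) by exact: measurableD.
rewrite mu_sum//; have -> : mus (E `\` N) = 0%E.
  by apply: subset_measure0 musN => //; exact: measurableC.
rewrite adde0; apply: measureD_null => //; exact: mua_la.
Qed.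

Lemma mua_le E : measurable E -> (mua E <= mu E)%E.
Proof. by move=> mE; rewrite mu_sum// leeDl. Qed.

Lemma mua01 E : measurable E -> mua (E `&` D) = mua E.
Proof.
move=> mE; have -> : E `&` D = E `\` ~` D by rewrite setDE setCK.
have mD : measurable (~` D) by apply: measurableC; exact: measurable01.
apply: measureD_null => //; apply/eqP.
by rewrite eq_le measure_ge0 andbT -mu01 mua_le.
Qed.

Lemma nu_dominated : ae_bounded_below la D g ->
  exists2 K : R, 0 < K & forall E, measurable E -> (nu E <= K%:E * mu E)%E.
Proof.
move=> [A A0 gA]; exists A^-1 => [|E mE]; first by rewrite invr_gt0.
have [M [mM M0 MP]] : {ae la, forall x, D x -> (A%:E <= r x)%E}.
  by apply: filterS2 gA gr => x h <-.
have mED : measurable (E `&` D) by apply: measurableI => //; exact: measurable01.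
have mF : measurable ((E `&` D) `\` M) by exact: measurableD.
rewrite lebesgue01E -(measureD_null mED mM M0) muleC lee_pdivlMr// muleC.
apply: le_trans (density_ge mF _ _) _.
- by move=> x [[]].
- by move=> x [[Ex Dx] Mx]; apply: contrapT => h; apply: Mx; apply: MP => /(_ Dx).
- apply: le_trans (mua_le mF) _; apply: le_measure; rewrite ?inE//.
  by move=> x [[]].
Qed.

Let mr : measurable_fun setT r. Proof. exact: measurable_int ir. Qed.

(** Where the density is below [1 / (2 * K)], and off [N], domination bounds the
Lebesgue measure by half of itself. *)
Lemma bounded_below_of_dominated (K : R) : 0 < K ->
  (forall E, measurable E -> (nu E <= K%:E * mu E)%E) -> ae_bounded_below la D g.
Proof.
move=> K0 nuK; pose c := (2 * K)^-1; have c0 : 0 < c by rewrite invr_gt0 mulr_gt0.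
exists c => //; pose S := D `&` [set x | (r x < c%:E)%E].
have mS : measurable S.
  by apply: emeasurable_fun_infty_o; [exact: measurable01|exact: measurable_funTS].
have SD : S `<=` D by move=> x [].
have S0 : la S = 0%E.
  have mSN : measurable (S `\` N) by exact: measurableD.
  have h1 : (mua S <= c%:E * la S)%E by apply: density_le => // x [_ /ltW].
  have h2 : (la S <= K%:E * mua S)%E.
    have := nuK _ mSN; rewrite mu_setDN// lebesgue01E setIidl; last by move=> x [/SD].
    by rewrite measureD_null.
  have /fineK lS : la S \is a fin_num by rewrite ge0_fin_numE// la01_lty.
  have /fineK mS' : mua S \is a fin_num by rewrite fin_num_measure.
  move: h1 h2; rewrite -lS -mS' -!EFinM !lee_fin => h1 h2.
  have l0 : 0 <= fine (la S) by rewrite fine_ge0.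
  have h3 : fine (la S) <= K * (c * fine (la S)) by rewrite (le_trans h2)// ler_pM2l.
  have e : K * (c * fine (la S)) = fine (la S) / 2 by rewrite /c; field; rewrite gt_eqF.
  by congr EFin; lra.
have aeS : {ae la, forall x, ~ S x} by exists S; split=> // x /contrapT.
apply: filterS2 aeS gr => x Sx -> Dx.
by rewrite leNgt; apply/negP => rx; apply: Sx.
Qed.

Lemma mu_setDN_le : ae_bounded_above_below la D g ->
  exists2 C : R, 0 < C & forall E, measurable E -> (mu (E `\` N) <= C%:E * nu E)%E.
Proof.
move=> [A [C [A0 A_le_C gC]]]; exists C => [|E mE]; first exact: lt_le_trans A_le_C.
have [M [mM M0 MP]] : {ae la, forall x, D x -> (r x <= C%:E)%E}.
  by apply: filterS2 gC gr => x h <- /h /andP[].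
have mED : measurable (E `&` D) by apply: measurableI => //; exact: measurable01.
have mF : measurable ((E `&` D) `\` M) by exact: measurableD.
rewrite mu_setDN// -mua01// -(measureD_null mED mM); last exact: mua_la.
rewrite lebesgue01E -(measureD_null mED mM M0).
apply: density_le => //.
- by move=> x [[]].
- by move=> x [[Ex Dx] Mx]; apply: contrapT => h; apply: Mx; apply: MP => /(_ Dx).
Qed.

(** Where the density exceeds [C + 1], the measure [mua] is at least [C + 1] times
and at most [C] times Lebesgue measure. *)
Lemma bounded_above_of_dominated (C : R) : 0 < C ->
  (forall E, measurable E -> (mua E <= C%:E * nu E)%E) ->
  {ae la, forall x, D x -> (g x <= (C + 1)%:E)%E}.
Proof.
move=> C0 muaC; pose S := D `&` [set x | ((C + 1)%:E < r x)%E].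
have mS : measurable S.
  by apply: emeasurable_fun_o_infty; [exact: measurable01|exact: measurable_funTS].
have SD : S `<=` D by move=> x [].
have S0 : la S = 0%E.
  have h1 : ((C + 1)%:E * la S <= mua S)%E by apply: density_ge => // x [_ /ltW].
  have := muaC _ mS; rewrite lebesgue01E setIidl// => h2.
  have /fineK lS : la S \is a fin_num by rewrite ge0_fin_numE// la01_lty.
  have := le_trans h1 h2; rewrite -lS -!EFinM !lee_fin => h.
  have l0 : 0 <= fine (la S) by rewrite fine_ge0.
  by congr EFin; lra.
have aeS : {ae la, forall x, ~ S x} by exists S; split=> // x /contrapT.
apply: filterS2 aeS gr => x Sx -> Dx.
by rewrite leNgt; apply/negP => rx; apply: Sx.
Qed.

Lemma mua_nu0 E : measurable E -> nu E = 0%E -> mua E = 0%E.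
Proof.
move=> mE; rewrite lebesgue01E -mua01// => la0; apply: mua_la => //.
by apply: measurableI => //; exact: measurable01.
Qed.

(** Otherwise there are sets [E k] with [mua (E k) > 4 ^ k * nu (E k)]. The series
of their indicators weighted by [2 ^ - k / nu (E k)] is integrable for [nu], while
its k-th term alone has integral at least [2 ^ k] for [mua]; its square root
contradicts the hypothesis. *)
Lemma dominated_of_sqint :
  (forall h : sqintType nu, exists u : sqintType mu, {ae nu, forall x, u x = h x}) ->
  exists2 C : R, 0 < C & forall E, measurable E -> (mua E <= C%:E * nu E)%E.
Proof.
move=> surj; apply: contrapT => noC.
have /choice[E EP] : forall k : nat, exists E,
    measurable E /\ ((4 ^+ k : R)%:E * nu E < mua E)%E.
  move=> k; apply: contrapT => h; apply: noC; exists (4 ^+ k); first by rewrite exprn_gt0.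
  by move=> E mE; rewrite leNgt; apply/negP => lt; apply: h; exists E.
have mE k : measurable (E k) by have [] := EP k.
pose e k := fine (nu (E k)).
have eE k : nu (E k) = (e k)%:E by rewrite fineK// fin_num_measure.
have e0 k : 0 < e k.
  rewrite lt_neqAle fine_ge0// andbT; apply/negP => /eqP/esym ek.
  have nuE0 : nu (E k) = 0%E by rewrite eE ek.
  by have := (EP k).2; rewrite nuE0 mule0 mua_nu0// ltxx.
pose c k : R := 2^-1 ^+ k / e k.
have c0 k : 0 < c k by rewrite divr_gt0// exprn_gt0// invr_gt0.
pose t k (x : T) : \bar R := ((c k)%:E * (\1_(E k) x)%:E)%E.
have t0 k x : (0 <= t k x)%E by rewrite mule_ge0// lee_fin// ltW.
have mt k : measurable_fun setT (t k).
  by apply: measurable_funeM; apply/measurable_EFinP; exact: measurable_indic.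
have intt (m : {finite_measure set T -> \bar R}) k :
    (\int[m]_x t k x = (c k)%:E * m (E k))%E.
  rewrite /t ge0_integralZl//; last 2 first.
  - by apply/measurable_EFinP; exact: measurable_indic.
  - by rewrite lee_fin ltW.
  by rewrite integral_indic// setIT.
pose W x := (\sum_(0 <= k <oo) t k x)%E.
have W0 x : (0 <= W x)%E by apply: nneseries_ge0 => k _ _; exact: t0.
have mW : measurable_fun setT W by apply: ge0_emeasurable_sum => // k x _ _; exact: t0.
have intW : (\int[nu]_x W x < +oo)%E.
  rewrite /W integral_nneseries//.
  rewrite (eq_eseriesr (g := fun k => (2^-1 ^+ k : R)%:E)); last first.
    move=> k _; rewrite intt.
    by rewrite [X in (_ * X)%E]eE -EFinM /c divfK// gt_eqF.
  exact: half_series_lty.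
have aeW : {ae nu, forall x, (W x < +oo)%E}.
  have iW : nu.-integrable setT W.
    apply/integrableP; split=> //.
    by under eq_integral do rewrite gee0_abs//.
  apply: filterS (integrable_ae measurableT iW) => x /(_ Logic.I).
  by rewrite ge0_fin_numE.
pose h (x : T) : R[i] := (Num.sqrt (fine (W x)))%:C.
have hE x : normc (h x) ^+ 2 = fine (W x).
  by rewrite /h normc_sqr/= expr0n addr0 sqr_sqrtr// fine_ge0.
have mh : measurable_fun setT (Re \o h).
  have ms : measurable_fun setT (@Num.sqrt R).
    by apply: continuous_measurable_fun; exact: sqrt_continuous.
  have mfW : measurable_fun setT (fun x => fine (W x)).
    exact: (measurableT_comp (fine_measurable measurableT) mW).
  exact: (measurableT_comp ms mfW).
have hsq : h \in sqint nu.
  apply/asboolP; split.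
  - exact: mh.
  - exact: measurable_cst.
  - apply: le_lt_trans intW; apply: ge0_le_integral => //.
    + by move=> x _; rewrite lee_fin sqr_ge0.
    + by apply: measurable_normc2 => //; exact: measurable_cst.
    + move=> x _; rewrite hE; case: (W x) (W0 x) => [y|//|//] _ //=.
have [u uh] := surj (SqInt hsq).
have aea (P : T -> Prop) : {ae nu, forall x, P x} -> {ae mua, forall x, P x}.
  by move=> [M [mM M0 MP]]; exists M; split=> //; exact: mua_nu0.
have mu2 := measurable_normc2 (sqint_measurableRe u) (sqint_measurableIm u).
pose F := (\int[mu]_x (normc (u x) ^+ 2)%:E)%E.
have Fk k : ((2 ^+ k : R)%:E <= F)%E.
  apply: (@le_trans _ _ (\int[mua]_x (normc (u x) ^+ 2)%:E)%E); last first.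
    apply: ge0_le_measure_integral => //; first exact: mua_le.
    by move=> x; rewrite lee_fin sqr_ge0.
  apply: (@le_trans _ _ (\int[mua]_x t k x)%E).
    rewrite intt; apply: (@le_trans _ _ ((c k)%:E * ((4 ^+ k)%:E * nu (E k)))%E).
      rewrite eE -!EFinM lee_fin (_ : c k * _ = (2^-1 * 4) ^+ k).
        by rewrite (_ : 2^-1 * 4 = 2)//; field.
      rewrite exprMn /c; move: (2^-1 ^+ k) (4 ^+ k) (e k) (e0 k) => a b z z0.
      by field; rewrite gt_eqF.
    by rewrite lee_pmul2l ?lte_fin//; apply: ltW; have [] := EP k.
  apply: ae_ge0_le_integral => //.
  - by move=> x _; rewrite lee_fin sqr_ge0.
  - apply: filterS2 (aea _ aeW) (aea _ uh) => x Wx -> _ /=.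
    rewrite hE fineK ?ge0_fin_numE//.
    have := @nneseries_lim_ge _ (t ^~ x) xpredT 0%N k.+1 (fun i _ _ => t0 i x).
    by apply: le_trans; rewrite big_nat_recr//= leeDr// sume_ge0.
have /fineK FE := sqint_fin u; rewrite -/F in FE.
have [k kF] : exists k : nat, fine F < k%:R.
  by exists (Num.truncn (fine F)).+1; exact: truncnS_gt.
have := Fk k; rewrite -FE lee_fin leNgt => /negP; apply.
by apply: lt_le_trans kF _; rewrite -natrX ler_nat ltnW// ltn_expl.
Qed.

End density.

(** * The three characterizations *)

Section main.
Context (R : realType).
Local Notation T := (measurableTypeR R).
Local Notation D := (`[0%R, 1%R[%classic : set T).
Local Notation la := (@lebesgue_measure R).
Local Notation nu := (lebesgue01 R).
Local Notation fnu := (fourier nu \o zof).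
Variable mu : {finite_measure set T -> \bar R}.
Hypothesis mu01 : mu (~` D) = 0%E.
Local Notation dot := (L2form mu).
Local Notation fmu := (fourier mu \o zof).

Lemma fnu_eq0 (u : L2 nu) : (forall k, L2form nu u (fnu k) = 0) -> u = 0.
Proof.
move=> u0; apply: (fourier_total (lebesgue01C R)) => n.
by rewrite -(nat_code_of_intK n); exact: u0.
Qed.

(** The Fourier coefficients of [h] are the coefficients of some vector along the
basis [B e_n]; a preimage of that vector restricts to [h]. *)
Lemma sqint_of_surjective (B : {linear L2 mu -> L2 mu}) (K : R) : 0 < K ->
  (forall E, measurable E -> (nu E <= K%:E * mu E)%E) ->
  bounded_operator dot B -> orthonormal_basis dot (B \o fourier mu) ->
  (forall v, exists u, B u = v) ->
  forall h : sqintType nu, exists u : sqintType mu, {ae nu, forall x, u x = h x}.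
Proof.
move=> K0 nuK bB oB sB h; have [Bo _] := (orthonormal_basisP _ _).1 oB.
have [v [vc _ _]] := orthonormal_expansion
  (c := fun k => L2form nu (L2class h) (fnu k)) (@L2_complete _ _ _ mu) Bo
  (fun N => bessel (L2class h) N (fnu_orthonormal R)).
have [u uv] := sB v.
have /L2class_eq uh : L2restr K0 nuK u = L2class h.
  apply/eqP; rewrite -subr_eq0; apply/eqP/fnu_eq0 => k.
  rewrite linearBl/= -(dot_operator mu01 K0 nuK bB Bo) uv.
  by apply/eqP; rewrite subr_eq0; apply/eqP; exact: vc.
by exists (L2repr u).
Qed.

(** The indicator of [N] restricts to zero in L2 of Lebesgue measure, so it is
killed by the operator. *)
Lemma null_of_injective (B : {linear L2 mu -> L2 mu}) (K : R) : 0 < K ->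
  (forall E, measurable E -> (nu E <= K%:E * mu E)%E) ->
  bounded_operator dot B -> orthonormal_basis dot (B \o fourier mu) ->
  injective B -> forall N, measurable N -> nu N = 0%E -> mu N = 0%E.
Proof.
move=> K0 nuK bB oB iB N mN N0; have [Bo Bt] := (orthonormal_basisP _ _).1 oB.
have R0 : L2restr K0 nuK (L2indic mu mN) = 0.
  have -> : L2restr K0 nuK (L2indic mu mN) = L2indic nu mN by exact: L2restr_class.
  apply: (hnorm_eq0 (dot := L2form nu)); apply/eqP; rewrite -sqrf_eq0.
  by rewrite -eqe hnorm_L2indic N0.
have /iB u0 : B (L2indic mu mN) = B 0.
  rewrite linear0; apply: (total_eq0 Bt) => k.
  by rewrite (dot_operator mu01 K0 nuK bB Bo) R0 linear0l.
by rewrite -(hnorm_L2indic mu mN) u0 hnorm0 expr0n.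
Qed.

(** The coefficients of [v] are the Fourier coefficients of a function [h] in L2 of
Lebesgue measure. Set to zero on [N], it belongs to L2 of [mu]. *)
Lemma surjective_of_dominated (B : {linear L2 mu -> L2 mu}) (K C : R) N : 0 < K ->
  (forall E, measurable E -> (nu E <= K%:E * mu E)%E) ->
  bounded_operator dot B -> orthonormal_basis dot (B \o fourier mu) ->
  measurable N -> nu N = 0%E -> 0 < C ->
  (forall E, measurable E -> (mu (E `\` N) <= C%:E * nu E)%E) ->
  forall v, exists u, B u = v.
Proof.
move=> K0 nuK bB oB mN N0 C0 muC v; have [Bo Bt] := (orthonormal_basisP _ _).1 oB.
have [h [hc _ _]] := orthonormal_expansion
  (c := fun k => dot v (B (fmu k))) (@L2_complete _ _ _ nu) (fnu_orthonormal R)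
  (fun n => bessel v n Bo).
have mNC := measurableC mN.
pose muN : {measure set T -> \bar R} := mrestr mu mNC.
have muNC E : measurable E -> (muN E <= C%:E * nu E)%E by move=> mE; exact: muC.
pose w (x : T) : R[i] := L2repr h x * (\1_(~` N) x)%:C.
have m1 : measurable_fun setT (\1_(~` N) : T -> R) by exact: measurable_indic.
have wRe : Re \o w = (fun x => Re (L2repr h x) * \1_(~` N) x).
  by apply/funext => x; rewrite /w /=; case: (L2repr h x) => a b /=; rewrite mulr0 subr0.
have wIm : Im \o w = (fun x => Im (L2repr h x) * \1_(~` N) x).
  by apply/funext => x; rewrite /w /=; case: (L2repr h x) => a b /=; rewrite mulr0 add0r.
have mRe : measurable_fun setT (Re \o w).
  by rewrite wRe; apply: measurable_funM => //; exact: sqint_measurableRe.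
have mIm : measurable_fun setT (Im \o w).
  by rewrite wIm; apply: measurable_funM => //; exact: sqint_measurableIm.
have wsq : w \in sqint mu.
  apply/asboolP; split => //.
  pose f (x : T) := ((normc (L2repr h x) ^+ 2)%:E : \bar R).
  have mf : measurable_fun setT f.
    by apply: measurable_normc2; [exact: sqint_measurableRe|exact: sqint_measurableIm].
  have f0 x : (0 <= f x)%E by rewrite lee_fin sqr_ge0.
  rewrite (_ : (\int[mu]_x _)%E = (\int[mu]_(x in ~` N) f x)%E); last first.
    rewrite [RHS]integral_mkcond; apply: eq_integral => x _.
    rewrite patchE /w indicE; case: (x \in ~` N).
      by rewrite mulr1.
    by rewrite mulr0 Normc.normc0 expr0n.
  rewrite -(@eq_measure_integral _ _ _ _ mu muN); last first.
    by move=> A mA AN; rewrite -[LHS]/(mu (A `&` ~` N)) setIidl.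
  apply: (@le_lt_trans _ _ (\int[muN]_x f x)%E).
    by apply: ge0_subset_integral => // x _.
  apply: le_lt_trans (le_integral_dominated C0 muNC f0 mf) _.
  by rewrite -(fineK (sqint_fin (L2repr h))) -EFinM ltry.
exists (L2class (SqInt wsq)).
apply/eqP; rewrite -subr_eq0; apply/eqP/(total_eq0 Bt) => k.
rewrite linearBl/= (dot_operator mu01 K0 nuK bB Bo).
have -> : L2restr K0 nuK (L2class (SqInt wsq)) = h.
  rewrite -[RHS]L2class_repr; apply/L2class_eq.
  apply: (@filterS2 _ _ _ _ _ _ _ (ae_dominated nuK (L2repr_class (SqInt wsq)))
    (_ : {ae nu, forall x, ~ N x})); last by exists N; split=> // x /contrapT.
  by move=> x /= -> Nx; rewrite /w indicE mem_set// mulr1.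
by rewrite -[B _]/(B (fmu k)) -hc subrr.
Qed.

(** Functions with the same image have restrictions with the same Fourier
coefficients, hence agree Lebesgue almost everywhere. *)
Lemma injective_of_dominating (B : {linear L2 mu -> L2 mu}) (K : R) : 0 < K ->
  (forall E, measurable E -> (nu E <= K%:E * mu E)%E) ->
  bounded_operator dot B -> orthonormal_basis dot (B \o fourier mu) ->
  (forall E, measurable E -> nu E = 0%E -> mu E = 0%E) -> injective B.
Proof.
move=> K0 nuK bB oB mu0 u v Buv; have [Bo Bt] := (orthonormal_basisP _ _).1 oB.
have /L2class_eq uv : L2restr K0 nuK u = L2restr K0 nuK v.
  apply/eqP; rewrite -subr_eq0 -L2restrB; apply/eqP/fnu_eq0 => k.
  rewrite -(dot_operator mu01 K0 nuK bB Bo) linearB/= Buv subrr.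
  by rewrite linear0l.
rewrite -(L2class_repr u) -(L2class_repr v); apply/L2class_eq.
by case: uv => N [mN N0 NP]; exists N; split=> //; exact: mu0.
Qed.

End main.

Lemma exponential_sequences (R : realType)
    (mu : {finite_measure set (measurableTypeR R) -> \bar R})
    (g : measurableTypeR R -> \bar R)
    (muC : mu (~` (`[0%R, 1%R[%classic : set (measurableTypeR R))) = 0%E)
    (hg : ac_density mu (@lebesgue_measure R) g) :
  [/\ riesz_fischer (L2form mu) (fourier mu) <->
        ae_bounded_below (@lebesgue_measure R) `[0%R, 1%R[%classic g,
      sco_sequence (L2form mu) (fourier mu) <->
        ae_bounded_above_below (@lebesgue_measure R) `[0%R, 1%R[%classic g &
      ico_sequence (L2form mu) (fourier mu) <->
        mu `<< (@lebesgue_measure R) /\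
        ae_bounded_below (@lebesgue_measure R) `[0%R, 1%R[%classic g].
Proof.
have mD := @measurable01 R.
have [mua [mus [[mua_la [N [mN musN laN]] mu_sum] gr]]] := hg.
set r := Radon_Nikodym _ _ in gr.
have mua_la' := (null_content_dominatesP mua lebesgue_measure).1 mua_la.
have cmua : charge_of_finite_measure mua `<< (@lebesgue_measure R).
  by apply/null_content_dominatesP => A mA A0; exact: mua_la'.
have ir : (@lebesgue_measure R).-integrable setT r by exact: Radon_Nikodym_integrable.
have mua_r A : measurable A -> (mua A = \int[lebesgue_measure]_(x in A) r x)%E.
  by move=> mA; exact: (Radon_Nikodym_integral cmua mA).
have nu0 : forall E, measurable E -> lebesgue_measure E = 0%E -> lebesgue01 R E = 0%E.
  move=> E mE E0; apply/eqP; rewrite eq_le measure_ge0 andbT lebesgue01E -E0.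
  by apply: le_measure; rewrite ?inE//; exact: measurableI.
have below_nu : ae_bounded_below lebesgue_measure `[0%R, 1%R[%classic g ->
    exists2 K : R, 0 < K & forall E, measurable E -> (lebesgue01 R E <= K%:E * mu E)%E.
  exact: (nu_dominated mu_sum ir mua_r gr).
have nu_below K : 0 < K -> (forall E, measurable E -> (lebesgue01 R E <= K%:E * mu E)%E) ->
    ae_bounded_below lebesgue_measure `[0%R, 1%R[%classic g.
  exact: (bounded_below_of_dominated mN laN musN mu_sum mua_la' ir mua_r gr).
have rf_nu := dominated_riesz_fischer muC.
split; split.
- by move=> /rf_nu[K K0 nuK]; exact: (nu_below K K0 nuK).
- by move=> /below_nu[K K0 nuK]; exact: (riesz_fischer_dominated K0 nuK).
- move=> [B [bB sB oB]]; have [K K0 nuK] := rf_nu (riesz_fischer_operator bB oB).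
  have [A A0 gA] := nu_below K K0 nuK.
  have [C C0 muaC] : exists2 C : R, 0 < C &
      forall E, measurable E -> (mua E <= C%:E * lebesgue01 R E)%E.
    apply: (dominated_of_sqint muC mu_sum mua_la').
    exact: (sqint_of_surjective muC K0 nuK bB oB sB).
  have gC := bounded_above_of_dominated ir mua_r gr C0 muaC.
  (* [A] and [C + 1] come from unrelated arguments and need not be ordered. *)
  exists (Num.min A (C + 1)), (C + 1); split.
  + by rewrite lt_min A0 ltr_wpDl// ltW.
  + by rewrite ge_min lexx orbT.
  + apply: filterS2 gA gC => x gA gC Dx; rewrite gC// andbT.
    by apply: le_trans (gA Dx); rewrite lee_fin ge_min lexx.
- move=> gAB; have [K K0 nuK] : exists2 K : R, 0 < K &
      forall E, measurable E -> (lebesgue01 R E <= K%:E * mu E)%E.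
    apply: below_nu; have [A [C [A0 _ gA]]] := gAB; exists A => //.
    by apply: filterS gA => x h /h /andP[].
  have [C C0 muNC] := mu_setDN_le muC mN laN musN mu_sum mua_la' ir mua_r gr gAB.
  have [B [bB oB]] := operator_exists muC K0 nuK.
  by exists B; split=> //; apply: (surjective_of_dominated muC K0 nuK bB oB mN (nu0 _ mN laN) C0 muNC).
- move=> [B [bB iB oB]]; have [K K0 nuK] := rf_nu (riesz_fischer_operator bB oB).
  split; last exact: (nu_below K K0 nuK).
  have muN : mu N = 0%E by apply: (null_of_injective muC K0 nuK bB oB iB) => //; exact: nu0.
  apply/null_content_dominatesP => A mA A0.
  transitivity (mu (A `\` N)); first by rewrite (measureD_null mA mN muN).
  rewrite (mu_setDN mN laN musN mu_sum mua_la' mA); exact: mua_la'.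
- move=> [mu_la /below_nu[K K0 nuK]].
  have [B [bB oB]] := operator_exists muC K0 nuK.
  exists B; split=> //; apply: (injective_of_dominating muC K0 nuK bB oB) => E mE.
  rewrite lebesgue01E => E0.
  have mED : measurable (E `&` `[0%R, 1%R[%classic) by exact: measurableI.
  have := (null_content_dominatesP mu lebesgue_measure).1 mu_la _ mED E0.
  by rewrite -(measureD_null mE (measurableC mD) muC) setDE setCK.
Qed.

Theorem theorem7p3 (R : realType) (mu : probability (measurableTypeR R) R)
    (g : measurableTypeR R -> \bar R)
    (mu01 : mu `[0%R, 1%R[%classic = 1%E)
    (hg : ac_density mu (@lebesgue_measure R) g) :
  [/\ riesz_fischer (L2form mu) (fourier mu) <->
        ae_bounded_below (@lebesgue_measure R) `[0%R, 1%R[%classic g,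
      sco_sequence (L2form mu) (fourier mu) <->
        ae_bounded_above_below (@lebesgue_measure R) `[0%R, 1%R[%classic g &
      ico_sequence (L2form mu) (fourier mu) <->
        mu `<< (@lebesgue_measure R) /\
        ae_bounded_below (@lebesgue_measure R) `[0%R, 1%R[%classic g].
Proof.
have muC : mu (~` (`[0%R, 1%R[%classic : set (measurableTypeR R))) = 0%E.
  by rewrite probability_setC ?mu01 ?subee//; exact: measurable01.
exact: (exponential_sequences muC hg).
Qed.
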